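(* Let $\mathbb{Y}=\{a,b\}$ be a two-letter alphabet and $\lambda$ a partition. Then \[ \sum_{\substack{\mu\\ \mu\text{ even}}} Q'_{\lambda/\mu}[-\mathbb{Y};t]=(-a)^{l(\lambda_{\mathrm{o}})}\,h_{\lambda_{\mathrm{e}}}(ab;t)\,h_{\lambda_{\mathrm{o}}}(b/a;t), \] where the sum is over all partitions $\mu$ all of whose parts are even.
   Context: For partitions, $f^{\lambda}_{\mu\nu}(t)$ are the Hall–Littlewood structure constants, $P_\mu P_\nu=\sum_\lambda f^\lambda_{\mu\nu}(t)P_\lambda$, where $P_\lambda(\cdot;t)$ is the Hall–Littlewood function; $Q_\lambda=b_\lambda(t)P_\lambda$ with $b_\lambda(t)=\prod_{i\ge1}(t;t)_{m_i(\lambda)}$, and the skew function is $Q_{\lambda/\mu}=\sum_\nu f^\lambda_{\mu\nu}(t)Q_\nu$. Plethystic notation: for a symmetric function $F$, $F[-\mathbb{Y}/(1-t)]$ is the specialization sending the power sum $p_r$ to $-(a^r+b^r)/(1-t^r)$, and $Q'_{\lambda/\mu}[-\mathbb{Y};t]:=Q_{\lambda/\mu}[-\mathbb{Y}/(1-t);t]$. $m_i(\lambda)$ is the multiplicity of part $i$, $l(\lambda)$ the number of parts, $\lambda_{\mathrm{e}}$, $\lambda_{\mathrm{o}}$ the partitions of even, resp. odd, parts of $\lambda$. Rogers–Szegő: $H_m(z;t)=\sum_{i=0}^m z^i\binom{m}{i}_t$, $\binom{m}{i}_t=\frac{(t;t)_m}{(t;t)_i(t;t)_{m-i}}$, $(t;t)_n=\prod_{k=1}^n(1-t^k)$,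 $h_\lambda(z;t)=\prod_{i\ge1}H_{m_i(\lambda)}(z;t)$. *)

(* Defs.v *)
From HB Require Import structures.
From mathcomp Require Import all_boot all_order all_fingroup all_algebra finmap.
From mathcomp Require Import boolp classical_sets cardinality fsbigop.
From mathcomp Require Import -(notations) monalg.
From mathcomp Require Import mpoly.

Set Implicit Arguments.
Unset Strict Implicit.
Unset Printing Implicit Defensive.

Import GRing.Theory.

Local Open Scope ring_scope.

Definition is_intpart (s : seq nat) : bool := sorted geq s && (0%N \notin s).

Record intpart : predArgType :=
  IntPart { parts :> seq nat; _ : is_intpart parts }.

HB.instance Definition _ := [isSub for parts].
HB.instance Definition _ := [Countable of intpart by <:].

Definition even_partition (s : seq nat) : bool := all (fun i => ~~ odd i) s.

Definition even_parts (s : seq nat) : seq nat := [seq i <- s | ~~ odd i].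
Definition odd_parts (s : seq nat) : seq nat := [seq i <- s | odd i].

Section RogersSzego.
Variables (F : fieldType) (t : F).

Definition tfact (n : nat) : F := \prod_(1 <= k < n.+1) (1 - t ^+ k).

Definition tbinom (m i : nat) : F := tfact m / (tfact i * tfact (m - i)).

Definition rogers_szego (m : nat) (z : F) : F :=
  \sum_(i < m.+1) z ^+ i * tbinom m i.

(* The products defining [rs_h] and [hl_b] run over all i >= 1; an i which is
   not a part contributes H_0(z;t) = 1, resp. (t;t)_0 = 1. *)
Definition rs_h (s : seq nat) (z : F) : F :=
  \prod_(i <- undup s) rogers_szego (count_mem i s) z.

Definition hl_b (s : seq nat) : F := \prod_(i <- undup s) tfact (count_mem i s).

End RogersSzego.

(* The F-algebra of symmetric functions, F a field of characteristic 0, as the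
   polynomial algebra F[p_1, p_2, ...] in the power sums; the generator of
   index i : nat is p_{i+1}. *)
Notation symfun F := (malg (cmonom nat) F).

Definition psum {F : fieldType} (r : nat) : symfun F :=
  mkmalgU (ucm r.-1) 1.

Section Specialization.
Variables (F : fieldType) (S : comNzRingType) (iota : {rmorphism F -> S}).

Definition mon_eval (g : nat -> S) (m : cmonom nat) : S :=
  \prod_(i <- finsupp (cmonom_val m)) g i.+1 ^+ m i.

Lemma mon_eval_is_mmorphism (g : nat -> S) : mmorphism (mon_eval g).
Proof.
have E m (d : {fset nat}) : (finsupp (cmonom_val m) `<=` d)%fset ->
    mon_eval g m = \prod_(i <- d) g i.+1 ^+ m i.
  move=> sub; rewrite /mon_eval; apply: big_fset_incl => // i _.
  by move=> /fsfun_dflt ->; rewrite expr0.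
split=> [m1 m2|]; last by rewrite /mon_eval mdom1 big_seq_fset0.
pose d := (finsupp (cmonom_val m1) `|` finsupp (cmonom_val m2))%fset.
rewrite (E m1 d) ?fsubsetUl // (E m2 d) ?fsubsetUr // (E _ d) ?mdomD //.
by rewrite -big_split /=; apply: eq_bigr => i _; rewrite cmM exprD.
Qed.

HB.instance Definition _ (g : nat -> S) :=
  isMultiplicative.Build (cmonom nat) S (mon_eval g) (mon_eval_is_mmorphism g).

(* The ring morphism extending iota and sending p_r to g r for all r >= 1. *)
Definition specialize (g : nat -> S) : {rmorphism symfun F -> S} :=
  monalg.mmap iota (mon_eval g).

Lemma specialize_psum (g : nat -> S) (r : nat) :
  (0 < r)%N -> specialize g (psum r) = g r.
Proof.
case: r => // r _; rewrite /specialize /psum /= monalg.mmapU.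
have -> : mon_eval g (ucm r) = g r.+1.
  by rewrite /mon_eval mdomU big_seq_fset1 cmUU expr1.
by apply: etrans (mul1r _); congr (_ * _); exact: rmorph1.
Qed.

End Specialization.

Section HallLittlewood.
Local Notation tofrac := (@FracField.tofrac _).
Variables (F : fieldType) (t : F).

(* Numerator and denominator of x^la * \prod_(i < j) (x_i - t x_j)/(x_i - x_j)
   in n variables, for n >= size la. *)
Definition hl_num (n : nat) (la : seq nat) : {mpoly F[n]} :=
  'X_[[multinom nth 0%N la i | i < n]] *
  \prod_(i < n) \prod_(j < n | (i < j)%N) ('X_i - t *: 'X_j).

Definition hl_den (n : nat) : {mpoly F[n]} :=
  \prod_(i < n) \prod_(j < n | (i < j)%N) ('X_i - 'X_j).

Definition hl_vfact (m : nat) : F :=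
  \prod_(1 <= k < m.+1) ((1 - t ^+ k) / (1 - t)).

(* v_la(t), la being padded to length n with n - size la zeros. *)
Definition hl_v (n : nat) (la : seq nat) : F :=
  hl_vfact (n - size la) * \prod_(i <- undup la) hl_vfact (count_mem i la).

(* P_la(x_1, ..., x_n; t) =
     v_la(t)^-1 \sum_(w in S_n) w(x^la \prod_(i < j) (x_i - t x_j)/(x_i - x_j)),
   a priori a rational function. *)
Definition hl_frac (n : nat) (la : seq nat) : {fraction {mpoly F[n]}} :=
  tofrac ((hl_v n la)^-1)%:MP *
  \sum_(w : 'S_n)
     tofrac (msym w (hl_num n la)) /
     tofrac (msym w (hl_den n)).

(* The restriction f(x_1, ..., x_n) of f to n variables. *)
Definition in_vars (n : nat) (f : symfun F) : {mpoly F[n]} :=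
  specialize (@mpolyC n F) (fun r => \sum_(i < n) 'X_i ^+ r) f.

(* The Hall-Littlewood function P_la(.; t): the element of the ring of
   symmetric functions which is P_la(x_1, ..., x_n; t) in n variables, for all
   n >= l(la). *)
Definition hl_P (la : intpart) : symfun F :=
  xget 0 [set f : symfun F | forall n : nat, (size la <= n)%N ->
            tofrac (in_vars n f) = hl_frac n la]%classic.

Definition hl_Q (la : intpart) : symfun F := hl_b t la *: hl_P la.

Definition hl_coord (f : symfun F) : intpart -> F :=
  xget (fun=> 0)
    [set c : intpart -> F | finite_set [set la | c la != 0] /\
        f = \sum_(la \in [set: intpart]) c la *: hl_P la]%classic.

(* f^la_{mu nu}(t): the coefficient of P_la in P_mu P_nu. *)
Definition hl_struct (la mu nu : intpart) : F :=
  hl_coord (hl_P mu * hl_P nu) la.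

Definition hl_skewQ (la mu : intpart) : symfun F :=
  \sum_(nu \in [set: intpart]%classic) hl_struct la mu nu *: hl_Q nu.

(* Q'_{la/mu}[-Y; t] = Q_{la/mu}[-Y/(1-t); t] for Y = {a, b} *)
Definition hl_skewQ' (a b : F) (la mu : intpart) : F :=
  specialize idfun (fun r => - (a ^+ r + b ^+ r) / (1 - t ^+ r))
    (hl_skewQ la mu).

End HallLittlewood.

(* Main.v *)
From HB Require Import structures.
Require Import Defs.
From mathcomp Require Import all_boot all_order all_algebra finmap.
From mathcomp Require Import boolp classical_sets cardinality fsbigop.
From mathcomp Require Import all_fingroup.
From mathcomp Require Import -(notations) monalg.
From mathcomp Require Import mpoly ring.

Set Implicit Arguments.
Unset Strict Implicit.
Unset Printing Implicit Defensive.

Import GRing.Theory.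

Local Open Scope ring_scope.

(** Write [H_r] for Jing's vertex operators, so that [Q_la = H_{la_1} H_{la_2} ... 1] ([word]), with
    the straightening rule [H_r H_{r+1} = t H_{r+1} H_r]. Let [D_x] ([dual_eval]) be the ring
    morphism [p_r -> p_r - x^r/(1-t^r)], that is [f[X] -> f[X - x/(1-t)]]. The argument has two
    halves.

    Skewing. Let [hform] be the bilinear form with [<Q_la, Q_mu> = b_la] if [la = mu] and 0
    otherwise; then [f^la_{mu nu} = <P_mu P_nu, Q_la>]. Multiplication by [e_k] is adjoint to
    [(-1)^k] times the coefficient of [x^k] in [D_x] ([hform_adjoint]), so a truncation of the
    product of the series of [(-a)^k e_k] and of [(-b)^l e_l] represents [D_a D_b]. Since
    [Q_nu[-Y/(1-t)]] is the constant term of [D_a D_b Q_nu], summing over [nu] gives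
    [Q'_{la/mu}[-Y]] as the coefficient of [Q_mu] in [D_a D_b Q_la] ([skew_kernel_sum],
    [hl_skewQ'_coordQ]). The left side of the theorem is therefore the value at [D_a D_b Q_la] of
    the functional sending [Q_mu] to 1 for [mu] even and to 0 otherwise ([even_sum]).

    Computing. One has [D_x H_{r+1} = (H_{r+1} - x H_r) D_x], and straightening turns this into a
    t-binomial expansion of [D_x H_{N+1}^m] ([dual_eval_iter_jing]). Hence, if a functional
    multiplies by [c_N] for each part [N], its composite with [D_x] multiplies by the sum of
    [binom(m,i)_t (-x c_N)^i c_{N+1}^(m-i)] for [m] parts equal to [N+1] ([part_weight_dual_eval]).
    With [c_N = [N even]] and [x = a], only one extreme term survives, and the new weight is [-a]
    for an odd part, 1 for an even one ([odd_sum_weight]). With this weight and [x = b] the sums are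
    [H_m(ab;t)] for even parts and [(-a)^m H_m(b/a;t)] for odd ones ([odd_sum_word]).

    The foundations remain: the words form a basis ([word_indep], [word_expansion]), and they are
    the functions [Q_la] defined by symmetrization. For the latter, a partial fraction expansion
    shows that [H_r] obeys in finitely many variables the same recursion as the sum over
    permutations ([eval_jing], [hl_sym_rec], [hl_frac_word]). *)

(** * Symmetric functions as the free commutative algebra on power sums *)

Section Morphisms.
Variables (F : fieldType).
Implicit Types f g : symfun F.

(** Every monomial of positive degree splits off one generator, so induction on the degree reaches
    all monomials, and linearity does the rest. *)
Lemma symfun_ind (P : symfun F -> Prop) :
  (forall f g, P f -> P g -> P (f + g)) ->
  (forall f g, P f -> P g -> P (f * g)) ->
  (forall c : F, P (c *: 1)) -> (forall r, (0 < r)%N -> P (psum r)) ->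
  forall f, P f.
Proof.
move=> PD PM PC Pp f; rewrite [f]monalgE.
have P0 : P 0 by rewrite -(scale0r 1); apply: PC.
have P1 : P 1 by rewrite -(scale1r 1); apply: PC.
have Pmon (m : cmonom nat) : P (mkmalgU m 1).
  have [n mn] := ubnP (monalg.mdeg m).
  elim: n m mn.
    by move=> m lm0; exfalso; move: lm0; rewrite ltn0.
  move=> n IHn m lmn; have {}lmn : (monalg.mdeg m <= n)%N by [].
  have [->|/eqP m1] := eqVneq m (monalg.one : cmonom nat); first exact: P1.
  have : finsupp (cmonom_val m) != fset0.
    by apply/negP => /eqP sm0; case: m1; apply/eqP/cmP => i; rewrite cm1;
       apply/eqP; rewrite cmE_eq0 sm0 in_fset0.
  case/fset0Pn => i im.
  have mE : m = monalg.mul (ucm i) (divcm m (ucm i)).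
    apply/eqP/cmP => j; rewrite cmM divcmE cmU.
    case: eqP => [<-|_]; last by rewrite add0n subn0.
    by rewrite subnKC // lt0n cmE_neq0.
  have -> : mkmalgU m 1 = psum i.+1 * mkmalgU (divcm m (ucm i)) 1 :> symfun F.
    by rewrite /psum /= malgM_def fgmulUU mulr1 -mE.
  apply: PM; first exact: Pp.
  apply: IHn; apply: leq_trans lmn; rewrite [in X in (_ < X)%N]mE monalg.mdegM monalg.mdegU.
  by rewrite add1n.
apply: (big_ind P); [exact: P0|exact: PD|move=> m _].
have -> : mkmalgU m (monalg.mcoeff m f) = ((monalg.mcoeff m f) *: 1) * mkmalgU m 1 :> symfun F.
  by rewrite -scalerAl mul1r -mul_malgC malgM_def fgmulUU monalg.mul1m mulr1.
apply: PM; [exact: PC|exact: Pmon].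
Qed.

Lemma specialize_scale (S : comNzRingType) (iota : {rmorphism F -> S})
  (g : nat -> S) (c : F) f :
  specialize iota g (c *: f) = iota c * specialize iota g f.
Proof.
by rewrite -mul_malgC rmorphM; congr (_ * _); rewrite /specialize /= monalg.mmapC.
Qed.

End Morphisms.

(** The polynomial algebra on the power sums, seen only through its universal property ([psa_spec])
    and its generation by them ([psa_ind]). The concrete carrier enters only at the end, through
    [symfun_algebra]. *)
Record power_sum_algebra (F : fieldType) := PowerSumAlgebra {
  psa_carrier :> comAlgType F;
  pwr : nat -> psa_carrier;
  psa_spec : forall S : comNzRingType, {rmorphism F -> S} -> (nat -> S) ->
    {rmorphism psa_carrier -> S};
  psa_spec_scale : forall S iota g (c : F) (f : psa_carrier),
    @psa_spec S iota g (c *: f) = iota c * psa_spec iota g f;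
  psa_spec_pwr : forall S iota g r, (0 < r)%N -> @psa_spec S iota g (pwr r) = g r;
  psa_ind : forall (P : psa_carrier -> Prop),
    (forall f g, P f -> P g -> P (f + g)) ->
    (forall f g, P f -> P g -> P (f * g)) ->
    (forall c : F, P (c *: 1)) -> (forall r, (0 < r)%N -> P (pwr r)) ->
    forall f, P f
}.

(** * Formal exponentials by Newton's recurrence *)

Section Exponentials.

Definition is_exp (S : pzRingType) (c a : nat -> S) :=
  a 0%N = 1 /\
  forall m, a m.+1 *+ m.+1 = \sum_(i < m.+1) c i.+1 * a (m - i)%N.

Definition torsion_free (V : zmodType) :=
  forall (x : V) n, x *+ n.+1 = 0 -> x = 0.

Definition conv (S : pzRingType) (a b : nat -> S) m :=
  \sum_(i < m.+1) a i * b (m - i)%N.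

Lemma is_exp_uniq (S : pzRingType) (c d a b : nat -> S) :
  torsion_free S -> is_exp c a -> is_exp d b ->
  (forall r, (0 < r)%N -> c r = d r) -> a =1 b.
Proof.
move=> tf [a0 aS] [b0 bS] cd m.
elim/ltn_ind: m => -[_|m IHm]; first by rewrite a0 b0.
apply/eqP; rewrite -subr_eq0; apply/eqP/(tf _ m).
rewrite mulrnBl aS bS -sumrB big1 // => i _.
by rewrite cd // IHm ?subrr // ltnS leq_subr.
Qed.

Lemma is_exp_conv (S : comNzRingType) (c d a b : nat -> S) :
  is_exp c a -> is_exp d b -> is_exp (fun r => c r + d r) (conv a b).
Proof.
move=> [a0 aS] [b0 bS]; split=> [|m].
  by rewrite /conv big_ord_recl big_ord0 a0 b0 mulr1 addr0.
(* Truncating the series to polynomials gives access to the Leibniz rule [derivM]; only coefficients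
   up to degree [m.+1] matter. *)
pose tr (x : nat -> S) := \poly_(i < m.+2) x i.
have trE x i : (i < m.+2)%N -> (tr x)`_i = x i by move=> im; rewrite coef_poly im.
have convE x y i : (i < m.+2)%N -> conv x y i = (tr x * tr y)`_i.
  move=> im; rewrite coefM; apply: eq_bigr => j _.
  by rewrite !trE // ?(leq_ltn_trans (leq_subr _ _)) // (leq_trans (ltn_ord j)).
have dE x y : (forall k, x k.+1 *+ k.+1 = \sum_(i < k.+1) y i.+1 * x (k - i)%N) ->
    forall k, (k < m.+1)%N -> (tr x)^`()`_k = (tr (fun i => y i.+1) * tr x)`_k.
  move=> xS k km; rewrite coef_deriv trE // xS coefM; apply: eq_bigr => j _.
  have jk := ltn_ord j; have jm : (j < m.+1)%N by apply: leq_trans jk km.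
  rewrite !trE //; first by rewrite (leq_ltn_trans (leq_subr _ _)) // ltnW.
  exact: ltnW.
have -> : conv a b m.+1 *+ m.+1 = ((tr a * tr b)^`())`_m.
  by rewrite coef_deriv -convE.
rewrite derivM coefD.
have -> : ((tr a)^`() * tr b)`_m = ((tr (fun i => c i.+1) * tr a) * tr b)`_m.
  rewrite !coefM; apply: eq_bigr => j _; congr (_ * _).
  by rewrite (dE _ c) // coefM.
have -> : (tr a * (tr b)^`())`_m = (tr (fun i => d i.+1) * tr a * tr b)`_m.
  rewrite mulrAC [_ * tr b * _]mulrC !coefM; apply: eq_bigr => j _; congr (_ * _).
  by rewrite (dE _ d) // ltnS leq_subr.
rewrite -coefD -!mulrDl -mulrA coefM; apply: eq_bigr => j _.
have jm := ltn_ord j.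
rewrite coefD !trE; try exact: ltnW.
by rewrite -convE // ltnS (leq_trans (leq_subr _ _)) // -ltnS ltnW.
Qed.

Lemma is_exp_rmorph (S T : pzRingType) (h : {rmorphism S -> T}) c a :
  is_exp c a -> is_exp (h \o c) (h \o a).
Proof.
move=> [a0 aS]; split=> [|m] /=; first by rewrite a0 rmorph1.
rewrite -(raddfMn h) aS raddf_sum; by apply: eq_bigr => i _; rewrite /= rmorphM.
Qed.

Lemma eq_is_exp (S : pzRingType) (c d a b : nat -> S) :
  (forall r, (0 < r)%N -> c r = d r) -> a =1 b -> is_exp c a -> is_exp d b.
Proof.
move=> cd ab [a0 aS]; split=> [|m]; first by rewrite -ab.
by rewrite -ab aS; apply: eq_bigr => i _; rewrite cd ?ab.
Qed.

Lemma conv_cancelr (S : pzRingType) (a b c : nat -> S) :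
  c 0%N = 1 -> conv a c =1 conv b c -> a =1 b.
Proof.
move=> c0 ac m; elim/ltn_ind: m => m IHm; have := ac m.
rewrite /conv !big_ord_recr /= subnn c0 !mulr1.
under eq_bigr => i _ do rewrite IHm //.
exact: addrI.
Qed.

(** The recurrence uses all earlier values, so the whole initial segment is carried along. *)
Fixpoint exp_list (F : fieldType) (A : lalgType F) (c : nat -> A) n : seq A :=
  if n is n'.+1 then
    rcons (exp_list c n')
      (n'.+1%:R^-1 *: \sum_(i < n'.+1) c i.+1 * (exp_list c n')`_(n' - i))
  else [:: 1].

Definition exp_seq (F : fieldType) (A : lalgType F) (c : nat -> A) n : A :=
  (exp_list c n)`_n.

Lemma exp_seqP (F : fieldType) (A : lalgType F) (c : nat -> A) :
  [pchar F] =i pred0 -> is_exp c (exp_seq c).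
Proof.
move=> ch0; split=> // m.
have szl n : size (exp_list c n) = n.+1 by elim: n => //= n IHn; rewrite size_rcons IHn.
have nthl n i : (i <= n)%N -> (exp_list c n)`_i = exp_seq c i.
  elim: n => [|n IHn]; first by rewrite leqn0 => /eqP ->.
  rewrite leq_eqVlt => /orP[/eqP -> //|im].
  by rewrite /= nth_rcons szl im IHn.
rewrite /exp_seq /= nth_rcons szl ltnn eqxx -scaler_nat scalerA mulfV; last first.
  by move/pcharf0P: ch0 => ->.
by rewrite scale1r; apply: eq_bigr => i _; rewrite nthl // leq_subr.
Qed.

Lemma torsion_free_lmod (F : fieldType) (V : lmodType F) :
  [pchar F] =i pred0 -> torsion_free V.
Proof.
move=> /pcharf0P ch0 x n /eqP.
by rewrite -scaler_nat scaler_eq0 ch0 => /eqP.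
Qed.

Lemma torsion_free_poly (S : nzRingType) : torsion_free S -> torsion_free {poly S}.
Proof.
move=> tf p n pn0; apply/polyP => i; rewrite coef0; apply: (tf _ n).
by rewrite -coefMn pn0 coef0.
Qed.

End Exponentials.

(** * Plethystic shifts of the alphabet *)

Section Shifts.
Variables (F : fieldType) (L : power_sum_algebra F).
Implicit Types (f : L) (g h : nat -> F).

Lemma psa_rmorph_ext (S : comNzRingType) (u v : {rmorphism L -> S}) :
  (forall c : F, u (c *: 1) = v (c *: 1)) ->
  (forall r, (0 < r)%N -> u (pwr L r) = v (pwr L r)) -> u =1 v.
Proof.
move=> uvC uvp; apply: psa_ind => // f1 f2.
  by rewrite !rmorphD => -> ->.
by rewrite !rmorphM => -> ->.
Qed.

(** Modifies the alphabet with a marking variable [z], here ['X]: [g = 1] adds the letter [z],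
    [g = -1] removes it, and [g r = - 1/(1-t^r)] is [f[X - z/(1-t)]]. The operators [shiftc g k] are
    the coefficients of [z^k]. *)
Definition shift g : {rmorphism L -> {poly L}} :=
  psa_spec L (polyC \o in_alg L) (fun r => (pwr L r)%:P + (g r)%:A%:P * 'X^r).

Lemma shift_pwr g r : (0 < r)%N ->
  shift g (pwr L r) = (pwr L r)%:P + (g r)%:A%:P * 'X^r.
Proof. exact: psa_spec_pwr. Qed.

Lemma shift_scale1 g (c : F) : shift g (c *: 1) = (c *: 1)%:P.
Proof. by rewrite psa_spec_scale rmorph1 mulr1. Qed.

Definition shiftc g k f : L := (shift g f)`_k.

Lemma shiftcZ g k (c : F) f : shiftc g k (c *: f) = c *: shiftc g k f.
Proof.
have -> : c *: f = (c *: 1) * f by rewrite -scalerAl mul1r.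
by rewrite /shiftc rmorphM shift_scale1 coefCM -scalerAl mul1r.
Qed.

Lemma shiftc_is_linear g k : linear (shiftc g k).
Proof.
move=> c f1 f2; rewrite -shiftcZ /shiftc.
by rewrite rmorphD coefD.
Qed.
HB.instance Definition _ g k :=
  GRing.isLinear.Build F L L _ (shiftc g k) (shiftc_is_linear g k).

Lemma shiftc0 g f : shiftc g 0 f = f.
Proof.
elim/psa_ind: f => [f1 f2|f1 f2|c|r r0]; rewrite /shiftc.
- by rewrite rmorphD coefD => -> ->.
- by rewrite rmorphM coef0M => -> ->.
- by rewrite shift_scale1 coefC.
- rewrite shift_pwr // coefD coefC coefCM coefXn /= eq_sym (gtn_eqF r0).
  by rewrite mulr0 addr0.
Qed.

Lemma shiftc_comm g h k l f :
  shiftc g k (shiftc h l f) = shiftc h l (shiftc g k f).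
Proof.
(* Both orders are carried out with two independent variables; [swapXY] identifies the two results,
   which agree on power sums. *)
pose u : {rmorphism L -> {poly {poly L}}} := map_poly (shift g) \o shift h.
pose v : {rmorphism L -> {poly {poly L}}} := swapXY \o (map_poly (shift h) \o shift g).
have uv : u =1 v.
  apply: psa_rmorph_ext => [c|r r0] /=.
    by rewrite !shift_scale1 !map_polyC /= !shift_scale1 swapXY_polyC map_polyC.
  rewrite !shift_pwr // !(rmorphD (map_poly _)) !(rmorphM (map_poly _)) /=.
  rewrite !map_polyC /= !map_polyXn !shift_pwr // !shift_scale1.
  rewrite (rmorphD swapXY) (rmorphM swapXY) (rmorphXn swapXY) /= swapXY_X.
  rewrite !swapXY_polyC (rmorphD (map_poly _)) (rmorphM (map_poly _)) /=.
  rewrite !map_polyC /= map_polyXn.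
  by rewrite polyCD polyCM polyC_exp -!addrA [X in _ + X = _]addrC.
transitivity (((u f)`_l)`_k); first by rewrite /u /= coef_map.
by rewrite uv /v /= coef_swapXY coef_map.
Qed.

(** Performing the two shifts with separate variables and then equating the variables (evaluation at
    ['X]) gives the shift by the sum; the coefficients follow by a Cauchy product. *)
Lemma shiftc_add g h k f :
  shiftc (fun r => g r + h r) k f = \sum_(i < k.+1) shiftc g i (shiftc h (k - i) f).
Proof.
pose u : {rmorphism L -> {poly L}} :=
  horner_eval 'X \o (map_poly (shift g) \o shift h).
have uE : shift (fun r => g r + h r) =1 u.
  apply: psa_rmorph_ext => [c|r r0] /=.
    by rewrite !shift_scale1 map_polyC /= shift_scale1 horner_evalE hornerC.
  rewrite !shift_pwr // rmorphD /= map_polyC /= shift_pwr // rmorphM /=.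
  rewrite map_polyC /= map_polyXn shift_scale1 horner_evalE hornerD hornerC hornerM.
  by rewrite hornerC hornerXn scalerDl polyCD mulrDl addrA.
rewrite {1}/shiftc uE /u /= horner_evalE horner_coef coef_sum.
pose n := maxn k.+1 (size (map_poly (shift g) (shift h f))).
transitivity (\sum_(i < n) (shift g (shift h f)`_i * 'X^i)`_k).
  rewrite (big_ord_widen n (fun i => ((map_poly (shift g) (shift h f))`_i * 'X^i)`_k)) ?leq_maxr //.
  rewrite big_mkcond; apply: eq_bigr => i _; rewrite coef_map; case: ltnP => // szi.
  by rewrite -(coef_map (shift g)) (nth_default _ szi) mul0r coef0.
rewrite -(big_mkord xpredT (fun i => (shift g (shift h f)`_i * 'X^i)`_k)).
rewrite (@big_cat_nat _ _ _ k.+1) //= ?leq_maxl //.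
rewrite [X in _ + X]big_nat_cond [X in _ + X]big1 ?addr0; last first.
  by move=> i /andP[/andP[ki _] _]; rewrite coefMXn ki.
rewrite big_mkord (reindex_inj rev_ord_inj) /=; apply: eq_bigr => i _.
by rewrite coefMXn ltnNge subSS leq_subr /= subKn // -ltnS.
Qed.

Lemma shiftc_dilate g (c : F) k f :
  shiftc (fun r => c ^+ r * g r) k f = c ^+ k *: shiftc g k f.
Proof.
elim/psa_ind: f k => [f1 f2 IH1 IH2|f1 f2 IH1 IH2|d|r r0] k.
- by rewrite !raddfD /= IH1 IH2.
- rewrite /shiftc !rmorphM !coefM scaler_sumr; apply: eq_bigr => i _.
  move: (IH1 i) (IH2 (k - i)%N); rewrite /shiftc => -> ->.
  by rewrite -scalerAl -scalerAr scalerA -exprD subnKC // -ltnS.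
- by rewrite /shiftc !shift_scale1 !coefC; case: eqP => [->|_]; rewrite ?scaler0 // expr0 scale1r.
- rewrite /shiftc !shift_pwr // !coefD !coefC !coefCM !coefXn.
  case: (altP (k =P r)) => [->|_]; last first.
    rewrite !mulr0 !addr0; case: eqP => [->|_]; by rewrite ?scaler0 // expr0 scale1r.
  by rewrite (gtn_eqF r0) !add0r !mulr1 scalerA.
Qed.

End Shifts.

(** * t-binomial coefficients and straightening of quasi-commuting operators *)

Section Binomials.
Variables (F : fieldType) (t : F).
Hypothesis t_generic : forall r : nat, (0 < r)%N -> t ^+ r != 1.

Lemma one_sub_exp_neq0 r : (0 < r)%N -> 1 - t ^+ r != 0.
Proof. by move=> r0; rewrite subr_eq0 eq_sym t_generic. Qed.

Lemma tfactS n : tfact t n.+1 = tfact t n * (1 - t ^+ n.+1).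
Proof. by rewrite /tfact big_nat_recr. Qed.

Lemma tfact0 : tfact t 0 = 1.
Proof. by rewrite /tfact big_geq. Qed.

Lemma tfact_neq0 n : tfact t n != 0.
Proof.
elim: n => [|n IHn]; first by rewrite tfact0 oner_neq0.
by rewrite tfactS mulf_neq0 // one_sub_exp_neq0.
Qed.

(** With truncated subtraction [tbinom t m i] does not vanish for [i > m]; the value 0 there makes
    both Pascal rules hold without side conditions. *)
Definition tbin m i := if (i <= m)%N then tbinom t m i else 0.

Lemma tbin0 m : tbin m 0 = 1.
Proof. by rewrite /tbin /tbinom tfact0 mul1r subn0 divff // tfact_neq0. Qed.

Lemma tbin_gt m i : (m < i)%N -> tbin m i = 0.
Proof. by move=> mi; rewrite /tbin leqNgt mi. Qed.

Lemma tbinn m : tbin m m = 1.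
Proof. by rewrite /tbin /tbinom leqnn subnn tfact0 mulr1 divff // tfact_neq0. Qed.

Lemma tbinE m i : (i <= m)%N -> tbin m i * (tfact t i * tfact t (m - i)) = tfact t m.
Proof. by move=> im; rewrite /tbin im /tbinom divfK // mulf_neq0 ?tfact_neq0. Qed.

Lemma tbin_neq0_mul m i x y :
  (i <= m)%N -> x * (tfact t i * tfact t (m - i)) = y * (tfact t i * tfact t (m - i)) ->
  x = y.
Proof. by move=> im; apply: mulIf; rewrite mulf_neq0 ?tfact_neq0. Qed.

Lemma tbin_pascal_up m i : tbin m.+1 i.+1 = tbin m i + t ^+ i.+1 * tbin m i.+1.
Proof.
case: (ltngtP m i) => [mi|im|<-]; last 1 first.
- by rewrite !tbinn tbin_gt // mulr0 addr0.
- by rewrite !tbin_gt // ?mulr0 ?addr0 // ltnW.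
apply: (@tbin_neq0_mul m.+1 i.+1); first exact: ltnW.
rewrite tbinE; last by rewrite ltnS ltnW.
rewrite subSS mulrDl.
have e1 : (m - i = (m - i.+1).+1)%N by rewrite -subSn.
have -> : tbin m i * (tfact t i.+1 * tfact t (m - i)) = tfact t m * (1 - t ^+ i.+1).
  by rewrite -(@tbinE m i) ?(ltnW im) // tfactS; ring.
have -> : t ^+ i.+1 * tbin m i.+1 * (tfact t i.+1 * tfact t (m - i)) =
    t ^+ i.+1 * (1 - t ^+ (m - i)) * tfact t m.
  by rewrite -(@tbinE m i.+1) // e1 [tfact t (_ - _).+1]tfactS; ring.
have -> : t ^+ i.+1 * (1 - t ^+ (m - i)) = t ^+ i.+1 - t ^+ m.+1.
  by rewrite mulrBr mulr1 -exprD addSn subnKC // ltnW.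
by rewrite tfactS; ring.
Qed.

Lemma tbin_sub m i : (i <= m)%N -> tbin m (m - i) = tbin m i.
Proof.
by move=> im; rewrite /tbin im leq_subr /tbinom subKn // [X in _ / X]mulrC.
Qed.

Lemma tbin_pascal_dn m i : tbin m.+1 i.+1 = tbin m i.+1 + t ^+ (m - i) * tbin m i.
Proof.
case: (ltngtP m i) => [mi|im|<-]; last 1 first.
- by rewrite !tbinn tbin_gt // add0r subnn expr0 mulr1.
- by rewrite !tbin_gt // ?mulr0 ?addr0 // ltnW.
rewrite -[LHS]tbin_sub; last exact: ltnW.
rewrite subSS.
have e1 : (m - i = (m - i.+1).+1)%N by rewrite -subSn.
rewrite e1 tbin_pascal_up -e1 (tbin_sub im) tbin_sub //.
exact: ltnW.
Qed.

Section Straightening.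
Variable V : lmodType F.
Variables (T : nat -> V -> V) (A B : {linear V -> V}).
Hypothesis TA : forall j f, T j (A f) = A (T j f) + B (T j.+1 f).

(** A noncommutative t-binomial theorem: moving [T] past each [A] either leaves it alone or turns
    that [A] into [B] and raises the index of [T]. Reordering the resulting words in [A] and [B]
    costs powers of [t], which Pascal's rule collects. [straighten_dn] is the same for the opposite
    commutation rule. *)
Lemma straighten_up :
  (forall f, A (B f) = t *: B (A f)) -> forall m j f,
  T j (iter m A f) =
  \sum_(i < m.+1) tbin m i *: iter i B (iter (m - i) A (T (j + i)%N f)).
Proof.
move=> AB m; elim: m => [|m IHm] j f.
  by rewrite big_ord_recl big_ord0 /= tbin0 scale1r !addn0 addr0.
have ABi i g : A (iter i B g) = t ^+ i *: iter i B (A g).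
  elim: i => [|i IHi]; first by rewrite expr0 scale1r.
  by rewrite /= AB IHi linearZ scalerA exprS.
rewrite iterS TA !IHm !linear_sum /=.
rewrite big_ord_recl [in RHS]big_ord_recl /= !tbin0 !subn0 !addn0 -addrA.
congr (_ + _); first by rewrite !scale1r.
under [in RHS]eq_bigr => i _ do
  rewrite /bump leq0n add1n tbin_pascal_up scalerDl subSS.
rewrite big_split /= addrC; congr (_ + _).
  by apply: eq_bigr => i _; rewrite linearZ /= addSnnS.
rewrite [RHS]big_ord_recr /= tbin_gt // mulr0 scale0r addr0.
apply: eq_bigr => i _; rewrite linearZ /= -!iterS ABi /bump leq0n add1n.
rewrite [t ^+ _ * _]mulrC scalerA; congr (_ *: iter _ _ _).
by rewrite -iterS subnSK.
Qed.

Lemma straighten_dn :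
  (forall f, B (A f) = t *: A (B f)) -> forall m j f,
  T j (iter m A f) =
  \sum_(i < m.+1) tbin m i *: iter (m - i) A (iter i B (T (j + i)%N f)).
Proof.
move=> BA m; elim: m => [|m IHm] j f.
  by rewrite big_ord_recl big_ord0 /= tbin0 scale1r !addn0 addr0.
have BAi i g : B (iter i A g) = t ^+ i *: iter i A (B g).
  elim: i => [|i IHi]; first by rewrite expr0 scale1r.
  by rewrite /= BA IHi linearZ scalerA exprS.
rewrite iterS TA !IHm !linear_sum /=.
rewrite big_ord_recl [in RHS]big_ord_recl /= !tbin0 !subn0 !addn0 -addrA.
congr (_ + _); first by rewrite !scale1r.
under [in RHS]eq_bigr => i _ do
  rewrite /bump leq0n add1n tbin_pascal_dn scalerDl subSS.
rewrite big_split /=; congr (_ + _).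
  rewrite [RHS]big_ord_recr /= tbin_gt // scale0r addr0.
  apply: eq_bigr => i _; rewrite linearZ /= -!iterS /bump leq0n add1n.
  by rewrite subnSK.
apply: eq_bigr => i _; rewrite linearZ /= -!iterS BAi.
by rewrite [t ^+ _ * _]mulrC scalerA addSnnS.
Qed.

End Straightening.
End Binomials.

(** * Jing's vertex operators and their commutation rule *)

Section JingOperators.
Variables (F : fieldType) (L : power_sum_algebra F) (t : F).
Hypothesis char0 : [pchar F] =i pred0.
Implicit Types (f : L).

(** The one-row functions [q_m(X;t)], with generating series [Q(z)]; [he] gives the elementary
    functions, with series [E(z)]. *)
Definition hq : nat -> L := exp_seq (fun r => (1 - t ^+ r) *: pwr L r).
Definition he : nat -> L := exp_seq (fun r => (-1) ^+ r.-1 *: pwr L r).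

Definition lin1 (S : pzRingType) (x : S) (j : nat) : S := [:: 1; - x]`_j.

Lemma is_exp_lin1 (S : pzRingType) (x : S) : is_exp (fun r => - x ^+ r) (lin1 x).
Proof.
split=> // -[|m]; first by rewrite big_ord_recl big_ord0 mulr1 addr0.
rewrite /lin1 /= nth_nil mul0rn !big_ord_recr /= subnn subSnn big1 ?add0r.
  by rewrite /= mulr1 mulrNN -exprSr subrr.
by move=> i _; rewrite subSn ?(ltnW (ltn_ord i)) // -[(m - i)%N]prednK ?subn_gt0 // /= nth_nil mulr0.
Qed.

Lemma conv_lin1 (S : comPzRingType) (a : nat -> S) (x : S) m :
  conv a (lin1 x) m.+1 = a m.+1 - x * a m.
Proof.
rewrite /conv !big_ord_recr /= subnn subSnn /lin1 /= mulr1 mulrN addrC.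
congr (_ + _); rewrite big1 ?add0r 1?mulrC // => i _.
by rewrite subSn ?(ltnW (ltn_ord i)) // -[(m - i)%N]prednK ?subn_gt0 // /= nth_nil mulr0.
Qed.

Lemma is_exp_dilate (A : algType F) (x : F) (c a : nat -> A) :
  is_exp c a -> is_exp (fun r => x ^+ r *: c r) (fun m => x ^+ m *: a m).
Proof.
move=> [a0 aS]; split=> [|m]; first by rewrite a0 expr0 scale1r.
rewrite scalerMnr aS scaler_sumr; apply: eq_bigr => i _.
have im : (i <= m)%N by rewrite -ltnS.
by rewrite -scalerAl -scalerAr scalerA -exprD addSn subnKC.
Qed.

Lemma hq_is_exp : is_exp (fun r => (1 - t ^+ r) *: pwr L r) hq.
Proof. exact: exp_seqP. Qed.
Lemma he_is_exp : is_exp (fun r => (-1) ^+ r.-1 *: pwr L r) he.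
Proof. exact: exp_seqP. Qed.

Lemma torsion_freeL : torsion_free L.
Proof. exact: torsion_free_lmod char0. Qed.
Lemma torsion_freeLX : torsion_free {poly L}.
Proof. exact/torsion_free_poly/torsion_freeL. Qed.

Lemma hq0 : hq 0 = 1. Proof. by []. Qed.
Lemma he0 : he 0 = 1. Proof. by []. Qed.

Lemma shiftZ g (c : F) f : shift L g (c *: f) = (c *: 1)%:P * shift L g f.
Proof. by rewrite -(shift_scale1 L g) -rmorphM -scalerAl mul1r. Qed.

Definition rem_var : {rmorphism L -> {poly L}} := shift L (fun _ => -1).

Lemma rem_var_pwr r : (0 < r)%N -> rem_var (pwr L r) = (pwr L r)%:P - 'X^r.
Proof. by move=> r0; rewrite /rem_var shift_pwr // scaleN1r polyCN mulNr mul1r. Qed.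

(** Removing a letter [y] multiplies [Q(z)] by [(1 - yz)/(1 - tyz)]; the statement is the
    coefficient identity with the denominator cleared. Likewise [E(z)] gets divided by [1 + yz] in
    [rem_var_he]. *)
Lemma rem_var_hq m :
  rem_var (hq m.+1) = (t *: 1)%:P * 'X * rem_var (hq m) + (hq m.+1)%:P - 'X * (hq m)%:P.
Proof.
have h1 := is_exp_conv (is_exp_rmorph rem_var hq_is_exp) (is_exp_lin1 ((t *: 1)%:P * 'X)).
have h2 := is_exp_conv (is_exp_rmorph (@polyC L) hq_is_exp) (is_exp_lin1 'X).
have := is_exp_uniq torsion_freeLX h1 h2; move=> /(_ _ m.+1).
rewrite !conv_lin1 /= => e; rewrite -addrA -e; first by rewrite addrC subrK.
move=> r r0 /=; rewrite /rem_var shiftZ rem_var_pwr //.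
rewrite exprMn -polyC_exp exprZn expr1n -[_ *: pwr L r]mulr_algl polyCM.
by rewrite scalerBl scale1r polyCB; ring.
Qed.

Lemma rem_var_he m : rem_var (he m.+1) = (he m.+1)%:P - 'X * rem_var (he m).
Proof.
have h1 := is_exp_conv (is_exp_rmorph rem_var he_is_exp) (is_exp_lin1 (- 'X : {poly L})).
have := is_exp_uniq torsion_freeLX h1 (is_exp_rmorph (@polyC L) he_is_exp).
move=> /(_ _ m.+1); rewrite conv_lin1 /= => e.
rewrite -e; first by rewrite mulNr opprK addrK.
case=> // r _ /=; rewrite /rem_var shiftZ rem_var_pwr // -[_ *: pwr L _]mulr_algl polyCM.
rewrite [(- 'X) ^+ _]exprNn [(-1) ^+ r.+1]exprS -(signr_odd F r) -(signr_odd {poly L} r); case: (odd r); rewrite ?expr0 ?expr1.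
  by rewrite scaleN1r polyCN; ring.
by rewrite scale1r; ring.
Qed.

Definition dual_shift : {rmorphism L -> {poly L}} := shift L (fun r => - (1 - t ^+ r)^-1).

Hypothesis t_generic : forall r : nat, (0 < r)%N -> t ^+ r != 1.

(** The factor [1 - t^r] in the exponent of [Q(z)] cancels the denominator of the shift, so [Q(z)]
    is just multiplied by [1 - yz]. *)
Lemma dual_shift_hq m : dual_shift (hq m.+1) = (hq m.+1)%:P - 'X * (hq m)%:P.
Proof.
have h1 := is_exp_rmorph dual_shift hq_is_exp.
have h2 := is_exp_conv (is_exp_rmorph (@polyC L) hq_is_exp) (is_exp_lin1 'X).
have := is_exp_uniq torsion_freeLX h1 h2; move=> /(_ _ m.+1).
rewrite conv_lin1 /= => -> // r r0 /=.
rewrite /dual_shift shiftZ shift_pwr // -[_ *: pwr L r]mulr_algl polyCM mulrDr mulrA.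
rewrite -polyCM -scalerAl mul1r scalerA mulrN mulfV ?one_sub_exp_neq0 //.
by rewrite scaleN1r polyCN mulN1r.
Qed.

(** Coefficients of [Q(z) E(-z) = E(-tz)]. *)
Lemma hq_he m :
  \sum_(i < m.+1) ((-1) ^+ (m - i) *: hq i) * he (m - i) = (- t) ^+ m *: he m.
Proof.
have h1 := is_exp_conv hq_is_exp (is_exp_dilate (-1) he_is_exp).
have h2 := is_exp_dilate (- t) he_is_exp.
have := is_exp_uniq torsion_freeL h1 h2; move=> /(_ _ m) <-.
  by apply: eq_bigr => i _; rewrite -scalerAl -scalerAr.
case=> // r _ /=; rewrite !scalerA -scalerDl; congr (_ *: _).
rewrite [(- t) ^+ r.+1]exprNn [(-1) ^+ r.+1]exprS -(signr_odd _ r).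
by case: (odd r); rewrite ?expr0 ?expr1; ring.
Qed.

Definition pair_hq r (p : {poly L}) : L := \sum_(m < size p) hq (r + m) * p`_m.

Lemma pair_hqE r (p : {poly L}) n : (size p <= n)%N ->
  pair_hq r p = \sum_(m < n) hq (r + m) * p`_m.
Proof.
move=> pn; rewrite /pair_hq (big_ord_widen n (fun m => hq (r + m) * p`_m)) //.
rewrite big_mkcond; apply: eq_bigr => i _; case: ltnP => // szi.
by rewrite nth_default // mulr0.
Qed.

Lemma pair_hq_is_zmod_morphism r : zmod_morphism (pair_hq r).
Proof.
move=> p q; pose n := maxn (size p) (size q).
have pqn : (size (p - q)%R <= n)%N.
  by rewrite (leq_trans (size_polyD _ _)) // size_polyN.
rewrite !(@pair_hqE r _ n) ?leq_maxl ?leq_maxr // -sumrB.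
by apply: eq_bigr => i _; rewrite coefB mulrBr.
Qed.
HB.instance Definition _ r :=
  GRing.isZmodMorphism.Build {poly L} L (pair_hq r) (pair_hq_is_zmod_morphism r).

Lemma pair_hqC r c p : pair_hq r (c%:P * p) = c * pair_hq r p.
Proof.
rewrite (@pair_hqE r _ (size p)); last first.
  by rewrite mul_polyC size_scale_leq.
by rewrite mulr_sumr; apply: eq_bigr => i _; rewrite coefCM mulrCA.
Qed.

Lemma pair_hqX r p : pair_hq r ('X * p) = pair_hq r.+1 p.
Proof.
rewrite (@pair_hqE r _ (size p).+1); last first.
  by rewrite mulrC (leq_trans (size_polyMleq _ _)) // size_polyX addn2.
rewrite big_ord_recl coefXM mulr0 add0r; apply: eq_bigr => i _.
by rewrite coefXM /= /bump leq0n addSnnS.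
Qed.

(** The coefficient of [z^r] in [Q(z) f[X - 1/z]]: [pair_hq r] replaces the power [m] of the removed
    letter by [q_{r+m}]. *)
Definition jing r f : L := pair_hq r (rem_var f).

Lemma jing_is_linear r : linear (jing r).
Proof.
by move=> c f g; rewrite /jing rmorphD raddfD /= /rem_var shiftZ pair_hqC mulr_algl.
Qed.
HB.instance Definition _ r := GRing.isLinear.Build F L L _ (jing r) (jing_is_linear r).

Lemma jing_sum r f : jing r f = \sum_(m < size (rem_var f)) hq (r + m) * shiftc (fun=> -1) m f.
Proof. by []. Qed.

(** Expanding [q_{m+1}[X - y]] by [rem_var_hq], the term with factor [t] yields the right-hand side.
    The rest is antisymmetric under exchange of the two removed letters, hence zero. *)
Lemma jing_straighten r f : jing r (jing r.+1 f) = t *: jing r.+1 (jing r f).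
Proof.
pose s := size (rem_var f); pose g l := shiftc (fun=> -1) l f.
have E u : rem_var (jing u f) = \sum_(l < s) rem_var (hq (u + l)) * rem_var (g l).
  by rewrite jing_sum rmorph_sum; apply: eq_bigr => i _; rewrite rmorphM.
rewrite {1}/jing E.
under eq_bigr => l _ do rewrite addSn rem_var_hq -addrA mulrDl.
rewrite big_split raddfD /=.
rewrite [X in X + _](_ : _ = t *: jing r.+1 (jing r f)); last first.
  rewrite /jing -/(jing r f) E [RHS]/= -[RHS]mulr_algl -pair_hqC -pair_hqX.
  rewrite mulr_sumr [in RHS]mulr_sumr; congr (pair_hq _ _).
  by apply: eq_bigr => l _; ring.
apply/eqP; rewrite -subr_eq0 addrC addrA addNr add0r; apply/eqP.
(* A common bound for both summation indices, so that the remainder becomes a sum over a square in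
   which they can be exchanged. *)
pose n := maxn s (\max_(l < s) size (rem_var (g l))).
have szn (l : 'I_n) : (size (rem_var (g l)) <= n)%N.
  case: (ltnP l s) => ls.
    by rewrite leq_max (bigmax_sup (Ordinal ls)) ?orbT.
  by rewrite /g /shiftc nth_default // rmorph0 size_poly0.
transitivity (\sum_(l < n) \sum_(m < n) (hq (r + l).+1 * hq (r + m) -
    hq (r + l) * hq (r.+1 + m)) * shiftc (fun=> -1) m (g l)).
  rewrite raddf_sum (big_ord_widen n (fun l => pair_hq r (((hq (r + l).+1)%:P -
     'X * (hq (r + l))%:P) * rem_var (g l)))) ?leq_maxl //.
  rewrite big_mkcond; apply: eq_bigr => l _; case: ltnP => [_|ls].
    rewrite mulrBl raddfB /= -mulrA pair_hqC pair_hqX pair_hqC.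
    rewrite !(@pair_hqE _ _ n) // !mulr_sumr -sumrB; apply: eq_bigr => m _.
    by rewrite -/(shiftc _ _ _); ring.
  rewrite big1 // => m _; rewrite /g [shiftc _ l f]nth_default // linear0 mulr0 //.
under eq_bigr => l _ do under eq_bigr => m _ do rewrite mulrBl.
under eq_bigr => l _ do rewrite sumrB.
rewrite sumrB; apply/eqP; rewrite subr_eq0; apply/eqP.
rewrite exchange_big /=; apply: eq_bigr => l _; apply: eq_bigr => m _.
by rewrite /g shiftc_comm [hq _ * hq _]mulrC addSn.
Qed.

End JingOperators.

(** * Words in the Jing operators; multiplication by e_k and the dual shift *)

Section JingWords.
Variables (F : fieldType) (L : power_sum_algebra F) (t : F).
Hypothesis char0 : [pchar F] =i pred0.
Hypothesis t_generic : forall r : nat, (0 < r)%N -> t ^+ r != 1.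
Implicit Types (f : L).

Local Notation hq := (hq L t).
Local Notation he := (he L).
Local Notation H := (@jing F L t).

(** Multiplication by [e_{k-j}], indexed by the drop [j] so that [emul_jing] has the form expected
    by [straighten_up]. The sign in [dsub] likewise brings [dshift_jing] into the form of
    [straighten_dn]. *)
Definition emul k j f : L := if (j <= k)%N then he (k - j) * f else 0.

Lemma emul_jing r k j f :
  emul k j (H r f) = H r (emul k j f) + H r.+1 (emul k j.+1 f).
Proof.
rewrite /emul; case: (ltngtP j k) => [jk|_|->]; rewrite ?linear0 ?addr0 //; last first.
  by rewrite subnn he0 !mul1r.
have -> : (k - j = (k - j.+1).+1)%N by rewrite subnSK.
set m := (k - j.+1)%N; rewrite [H r (he m.+1 * f)]/jing rmorphM rem_var_he //.
rewrite mulrBl raddfB /= pair_hqC -mulrA pair_hqX -rmorphM.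
by rewrite subrK.
Qed.

Definition dshift k f : L := shiftc (fun r => - (1 - t ^+ r)^-1) k f.
HB.instance Definition _ k :=
  GRing.isLinear.Build F L L _ (dshift k)
    (shiftc_is_linear (fun r => - (1 - t ^+ r)^-1) k).

Lemma dshift0 f : dshift 0 f = f.
Proof. exact: shiftc0. Qed.

Lemma dshift_jing r k f :
  dshift k.+1 (H r.+1 f) = H r.+1 (dshift k.+1 f) - H r (dshift k f).
Proof.
pose s := size (rem_var L f).
have E u l : H u (dshift l f) = \sum_(m < s) hq (u + m) * dshift l (shiftc (fun=> -1) m f).
  rewrite /jing (@pair_hqE _ _ _ _ _ s).
    by apply: eq_bigr => m _; rewrite /dshift -shiftc_comm.
  apply/leq_sizeP => m sm; rewrite -/(shiftc _ _ _) /dshift -shiftc_comm.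
  by rewrite [shiftc (fun=> -1) m f]nth_default // linear0.
rewrite !E -sumrB {1}/dshift /shiftc jing_sum rmorph_sum coef_sum.
apply: eq_bigr => m _; rewrite rmorphM addSn (dual_shift_hq _ char0 t_generic).
by rewrite mulrBl coefB coefCM -mulrA coefXM coefCM.
Qed.

Definition dsub k j f : L := if (j <= k)%N then (-1) ^+ j *: dshift (k - j) f else 0.

Lemma dsub_jing r k j f :
  dsub k j (H r.+1 f) = H r.+1 (dsub k j f) + H r (dsub k j.+1 f).
Proof.
rewrite /dsub; case: (ltngtP j k) => [jk|_|->]; rewrite ?linear0 ?addr0 //; last first.
  by rewrite subnn !dshift0 linearZ.
have -> : (k - j = (k - j.+1).+1)%N by rewrite subnSK.
by rewrite dshift_jing !linearZ /= scalerBr exprS mulN1r scaleNr.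
Qed.

Lemma rem_var_const (c : F) : rem_var L (c *: 1) = (c *: 1)%:P.
Proof. exact: shift_scale1. Qed.

Lemma jing1 r : H r 1 = hq r.
Proof. by rewrite /jing rmorph1 (@pair_hqE _ _ _ _ _ 1%N) ?size_poly1 // big_ord1 coef1 addn0 mulr1. Qed.

Lemma rem_var_he_coef k m :
  (rem_var L (he k))`_m = if (m <= k)%N then (-1) ^+ m *: he (k - m) else 0.
Proof.
elim: k m => [|k IHk] m.
  by rewrite he0 rmorph1 coef1; case: m => [|m] //=; rewrite expr0 scale1r.
rewrite rem_var_he // coefB coefC coefXM IHk; case: m => [|m] /=.
  by rewrite subr0 expr0 scale1r.
rewrite sub0r subSS ltnS; case: leqP => _; last by rewrite oppr0.
by rewrite exprS mulN1r scaleNr.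
Qed.

(** The sum defining the left side is the convolution of [hq_he] in degree [k.+1], up to a sign and
    without its [i = 0] term. *)
Lemma jing_he k : H 1 (he k) = (1 - t ^+ k.+1) *: he k.+1.
Proof.
rewrite /jing (@pair_hqE _ _ _ _ _ k.+1); last first.
  by apply/leq_sizeP => m km; rewrite rem_var_he_coef leqNgt km.
have := hq_he L t char0 k.+1; rewrite big_ord_recl subn0 hq0 -scalerAl mul1r => e.
have nz : (-1) ^+ k != 0 :> F by rewrite signr_eq0.
apply: (scalerI nz); rewrite scaler_sumr scalerA.
transitivity ((- t) ^+ k.+1 *: he k.+1 - (-1) ^+ k.+1 *: he k.+1).
  rewrite -e addrC addrA addNr add0r; apply: eq_bigr => i _.
  have ik : (i <= k)%N by rewrite -ltnS.
  rewrite rem_var_he_coef ik /= /bump leq0n !add1n subSS -scalerAl -scalerAr.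
  rewrite scalerA -{1}(subnK ik) exprD -mulrA -expr2 sqrr_sign mulr1.
  by [].
rewrite -scalerBl; congr (_ *: _); rewrite [(- t) ^+ _]exprNn !exprS -(signr_odd F k).
by case: (odd k); rewrite ?expr0 ?expr1; ring.
Qed.

Definition word (s : seq nat) : L := foldr H 1 s.

Lemma word_cat s1 s2 : word (s1 ++ s2) = foldr H (word s2) s1.
Proof. exact: foldr_cat. Qed.

Lemma word_nseq m r s : word (nseq m r ++ s) = iter m (H r) (word s).
Proof. by elim: m => //= m ->. Qed.

Lemma word_zeros s k : word (s ++ nseq k 0%N) = word s.
Proof.
rewrite word_cat; congr foldr; elim: k => //= k ->.
by rewrite jing1 hq0.
Qed.

Lemma word_ones k : word (nseq k 1%N) = tfact t k *: he k.
Proof.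
elim: k => [|k IHk]; first by rewrite tfact0 scale1r.
by rewrite /= IHk linearZ /= jing_he scalerA tfactS.
Qed.

Lemma dshift_word_gt s k : 0%N \notin s -> (size s < k)%N -> dshift k (word s) = 0.
Proof.
elim: s k => [|r s IHs] [|k] //=.
  by move=> _ _; rewrite /dshift /shiftc rmorph1 coef1.
rewrite inE negb_or eq_sym -lt0n ltnS => /andP[r0 s0] sk.
rewrite -(prednK r0) dshift_jing !IHs //; last exact: leqW.
by rewrite !linear0 addr0.
Qed.

(** By [dshift_jing] the dual shift lowers parts by one, each at most once. In degree [size s] every
    part must be lowered, which removes the first column; in higher degree nothing survives. *)
Lemma dshift_word_top s : 0%N \notin s ->
  dshift (size s) (word s) = (-1) ^+ size s *: word (map predn s).
Proof.
elim: s => [|r s IHs] /=.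
  by move=> _; rewrite dshift0 expr0 scale1r.
rewrite inE negb_or eq_sym -lt0n => /andP[r0 s0].
rewrite -{1}(prednK r0) dshift_jing dshift_word_gt // linear0 sub0r IHs //.
by rewrite linearZ exprS mulN1r scaleNr.
Qed.

Definition restr n : {rmorphism L -> {mpoly F[n]}} :=
  psa_spec L (@mpolyC n F) (fun r => \sum_(i < n) 'X_i ^+ r).

Definition vanishing N f := forall n, (N <= n)%N -> restr n f = 0.

(** Restricting [f[X + z]] to [n] variables is restricting [f] to [n.+1] variables and calling one
    of them [z]. *)
Lemma restr_add_var n k f :
  restr n.+1 f = 0 -> restr n (shiftc (fun=> 1) k f) = 0.
Proof.
move=> f0.
pose th : {rmorphism {mpoly F[n.+1]} -> {poly {mpoly F[n]}}} :=
  mmap (polyC \o @mpolyC n F)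
    (fun i => if unlift ord0 i is Some j then ('X_j)%:P else 'X).
have thE : th \o restr n.+1 =1 map_poly (restr n) \o shift L (fun=> 1).
  apply: psa_rmorph_ext => [c|r r0] /=.
    by rewrite shift_scale1 map_polyC /= !psa_spec_scale !rmorph1 !mulr1 mmapC.
  rewrite shift_pwr // scale1r polyC1 mul1r rmorphD /= !map_polyC /= map_polyXn.
  rewrite !psa_spec_pwr // big_ord_recl.
  rewrite rmorphD rmorph_sum /= rmorphXn /= mmapX mmap1U unlift_none addrC.
  congr (_ + _); rewrite rmorph_sum /=; apply: eq_bigr => i _.
  by rewrite rmorphXn /= mmapX mmap1U liftK polyC_exp.
have := thE f; rewrite /= f0 rmorph0 => /polyP/(_ k).
by rewrite coef0 coef_map.
Qed.

Lemma eq_shiftc (g h : nat -> F) k f :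
  (forall r, (0 < r)%N -> g r = h r) -> shiftc g k f = shiftc h k f.
Proof.
move=> gh; have e : shift L g =1 shift L h.
  apply: psa_rmorph_ext => [c|r r0]; first by rewrite !shift_scale1.
  by rewrite !shift_pwr // gh.
by rewrite /shiftc e.
Qed.

(** Subtracting [tz/(1-t)] is the same as adding the letter [z] and subtracting [z/(1-t)]. Comparing
    coefficients of [z^k] and dividing by [t^k - 1] expresses [dshift k] through lower ones followed
    by adding a letter, which preserves vanishing. *)
Lemma vanishing_dshift N k f : vanishing N f -> vanishing N (dshift k f).
Proof.
move=> f0; elim/ltn_ind: k => -[_|k IHk]; first by rewrite dshift0.
move=> n Nn.
have := shiftc_dilate (fun r => - (1 - t ^+ r)^-1) t k.+1 f.
have -> : shiftc (fun r => t ^+ r * - (1 - t ^+ r)^-1) k.+1 f =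
          shiftc (fun r => 1 + - (1 - t ^+ r)^-1) k.+1 f.
  apply: eq_shiftc => r r0.
  have := one_sub_exp_neq0 t_generic r0; move: (t ^+ r) => x x0.
  by field.
rewrite shiftc_add big_ord_recl shiftc0 subn0 -/(dshift _ _) => e.
have tk : t ^+ k.+1 - 1 != 0 by rewrite subr_eq0 t_generic.
have {}e : dshift k.+1 f = (t ^+ k.+1 - 1)^-1 *:
   \sum_(i < k.+1) shiftc (fun=> 1) (lift ord0 i) (dshift (k.+1 - lift ord0 i) f).
  apply: (scalerI tk); rewrite scalerA mulfV // scale1r scalerBl scale1r -e.
  by rewrite addrAC subrr add0r.
rewrite e psa_spec_scale rmorph_sum big1 ?mulr0 // => i _.
apply: restr_add_var; apply: IHk; last exact: leqW.
by rewrite /= /bump leq0n add1n subSS ltnS leq_subr.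
Qed.

End JingWords.

(** * The words of partitions form a basis *)

Section Basis.
Variables (F : fieldType) (L : power_sum_algebra F) (t : F).
Hypothesis char0 : [pchar F] =i pred0.
Hypothesis t_generic : forall r : nat, (0 < r)%N -> t ^+ r != 1.
Implicit Types (f : L) (s : seq nat).

Local Notation H := (@jing F L t).
Local Notation word := (@word F L t).

Lemma is_intpart_cons x s :
  is_intpart (x :: s) = [&& (0 < x)%N, all (leq^~ x) s & is_intpart s].
Proof.
rewrite /is_intpart /= inE negb_or eq_sym -lt0n path_sortedE; last first.
  by move=> a b c /= ab bc; exact: leq_trans bc ab.
by case: (0 < x)%N; rewrite ?andbF //= andbA.
Qed.

Definition col_remove s := [seq x <- map predn s | (0 < x)%N].
Definition col_add n s := map succn s ++ nseq (n - size s) 1%N.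

Lemma map_predn_intpart s : is_intpart s ->
  map predn s = col_remove s ++ nseq (size s - size (col_remove s)) 0%N.
Proof.
elim: s => //= x s IHs; rewrite is_intpart_cons => /and3P[x0 xs /IHs{}IHs].
rewrite /col_remove /=; case: (posnP x.-1) => [x1|x1] /=; last first.
  by rewrite subSS -IHs.
have x1E : x = 1%N by case: x x0 x1 {xs} => [|[]].
have s0 y : y \in map predn s -> y = 0%N.
  move=> /mapP[z /(allP xs)]; rewrite x1E => /= z1 ->.
  by case: z z1 => [|[]].
have -> : [seq y <- map predn s | (0 < y)%N] = [::].
  by apply/eqP; rewrite -size_eq0 size_filter -leqn0 leqNgt -has_count;
     apply/negP => /hasP[y /s0 ->].
have sE : map predn s = nseq (size s) 0%N.
  by rewrite -(size_map predn); apply/all_pred1P/allP => y /s0 ->.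
by rewrite x1 sE.
Qed.

Lemma is_intpart_col_remove s : is_intpart s -> is_intpart (col_remove s).
Proof.
elim: s => //= x s IHs; rewrite is_intpart_cons => /and3P[x0 xs /IHs{}IHs].
rewrite /col_remove /=; case: ifP => // x1; rewrite is_intpart_cons x1 IHs andbT /=.
apply/allP => y; rewrite mem_filter => /andP[_ /mapP[z zs ->]].
by have := allP xs z zs; case: z {zs} => [|z]; case: x {xs x1} x0.
Qed.

Lemma col_removeK s : is_intpart s -> col_add (size s) (col_remove s) = s.
Proof.
move=> si; have := congr1 (map succn) (map_predn_intpart si).
rewrite map_cat map_nseq -/(col_add _ _) => <-.
rewrite -map_comp -[RHS]map_id; apply/eq_in_map => x xs /=.
by rewrite prednK // lt0n; apply: contraTneq xs => ->; case/andP: si.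
Qed.

Lemma sumn_col_remove s : is_intpart s -> (sumn (col_remove s) + size s = sumn s)%N.
Proof.
move=> si; have -> : sumn (col_remove s) = sumn (map predn s).
  by rewrite [in RHS]map_predn_intpart // sumn_cat sumn_nseq mul0n addn0.
elim: s si => //= x s IHs; rewrite is_intpart_cons => /and3P[x0 _ /IHs <-].
by rewrite -{2}(prednK x0) addnS addSn addnA.
Qed.

Lemma dshift_intpart_top s : is_intpart s ->
  dshift t (size s) (word s) = (-1) ^+ size s *: word (col_remove s).
Proof.
move=> si; rewrite dshift_word_top //; last by case/andP: si.
by rewrite map_predn_intpart // word_zeros.
Qed.

(** Linear independence, even after restriction to large numbers of variables. It is phrased with
    arbitrary values [w] because [r] may list a partition several times. The induction is on the
    weight and, inside it, on the maximal length. *)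
Lemma word_indep N (r : seq (F * seq nat)) (V : lmodType F) (w : seq nat -> V) :
  all (fun x => is_intpart x.2) r ->
  vanishing N (\sum_(x <- r) x.1 *: word x.2) -> \sum_(x <- r) x.1 *: w x.2 = 0.
Proof.
pose B := (\max_(x <- r) sumn x.2).+1.
have : all (fun x => sumn x.2 < B)%N r.
  by apply/allP => x xr; rewrite /B ltnS (big_rem x) //= leq_maxl.
move: (B) => {}B; elim: B V w r => [|B IHB] V w r.
  by case: r => [|x r] // _ _ _; rewrite big_nil.
pose M := \max_(x <- r) size x.2.
have : all (fun x => size x.2 <= M)%N r.
  by apply/allP => x xr; rewrite /M (big_rem x) //= leq_maxl.
move: (M) => {}M; elim: M V w r => [|M IHM] V w r rM rB ri.
  have r0 (U : lmodType F) (v : seq nat -> U) :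
      \sum_(x <- r) x.1 *: v x.2 = (\sum_(x <- r) x.1) *: v [::].
    rewrite scaler_suml big_seq [RHS]big_seq; apply: eq_bigr => x xr.
    by have := allP rM x xr; rewrite leqn0 size_eq0 => /eqP ->.
  rewrite !r0 => /(_ N (leqnn N)); rewrite psa_spec_scale rmorph1 mulr1 => /eqP.
  by rewrite mpolyC_eq0 => /eqP ->; rewrite scale0r.
pose top (x : F * seq nat) := size x.2 == M.+1.
move=> van.
(* The words of maximal length are isolated by [dshift M.+1], which kills the shorter ones and
   strips the first column from these, lowering the weight; [col_add M.+1] restores the column. *)
have r1E (U : lmodType F) (v : seq nat -> U) : \sum_(x <- r | top x) x.1 *: v x.2 = 0.
  pose r' := [seq (x.1 * (-1) ^+ M.+1, col_remove x.2) | x <- r & top x].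
  have r'i : all (fun x => is_intpart x.2) r'.
    rewrite all_map; apply/allP => x; rewrite mem_filter => /andP[_ xr] /=.
    exact/is_intpart_col_remove/(allP ri).
  have r'B : all (fun x => sumn x.2 < B)%N r'.
    rewrite all_map; apply/allP => x; rewrite mem_filter => /andP[/eqP xM xr] /=.
    have := allP rB x xr; rewrite -(sumn_col_remove (allP ri x xr)) xM addnS !ltnS.
    by apply: leq_ltn_trans; rewrite leq_addr.
  have := IHB U (v \o col_add M.+1) r' r'B r'i.
  rewrite !big_map !big_filter /= => IH.
  apply: (@scalerI _ _ ((-1) ^+ M.+1)); first by rewrite signr_eq0.
  rewrite scaler0 -[RHS]IH.
    rewrite scaler_sumr big_seq_cond [RHS]big_seq_cond.
    apply: eq_bigr => x /andP[xr /eqP xM].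
    by rewrite scalerA [_ * x.1]mulrC -xM col_removeK // (allP ri).
  move=> {IH}; have := vanishing_dshift t_generic M.+1 van.
  rewrite linear_sum (bigID top) /= [X in _ + X]big1_seq ?addr0; last first.
    move=> x /andP[xM xr]; rewrite linearZ /= dshift_word_gt ?scaler0 //.
      by have /andP[] := allP ri x xr.
    by rewrite ltn_neqAle xM (allP rM x xr).
  rewrite big_seq_cond [X in _ -> vanishing _ X]big_seq_cond.
  congr (vanishing N _); apply: eq_bigr => x /andP[xr /eqP xM].
  by rewrite linearZ /= -xM dshift_intpart_top ?(allP ri) // scalerA.
rewrite (bigID top) /= r1E add0r -big_filter.
apply: IHM.
- apply/allP => x; rewrite mem_filter => /andP[xM /(allP rM)].
  by rewrite /= leq_eqVlt -/(top x) (negPf xM).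
- by apply/allP => x; rewrite mem_filter => /andP[_ /(allP rB)].
- by apply/allP => x; rewrite mem_filter => /andP[_ /(allP ri)].
by move: van; rewrite (bigID top) /= r1E add0r -big_filter.
Qed.

(** The span of the words with parts at most [N]. This filtration lets later arguments peel off all
    copies of the largest part at once, as a block [iter m (H N.+1)]. *)
Inductive spanned (N : nat) : L -> Prop :=
| spanned0 : spanned N 0
| spanned_cons c s f : is_intpart s -> all (leq^~ N) s -> spanned N f ->
    spanned N (c *: word s + f).

Lemma spannedD N f g : spanned N f -> spanned N g -> spanned N (f + g).
Proof.
by move=> Nf Ng; elim: Nf => [|c s h si sN _ IH]; rewrite ?add0r // -addrA; constructor.
Qed.

Lemma spannedZ N c f : spanned N f -> spanned N (c *: f).
Proof.
elim=> [|d s h si sN _ IH]; first by rewrite scaler0; constructor.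
by rewrite scalerDr scalerA; constructor.
Qed.

Lemma spanned_word N s : is_intpart s -> all (leq^~ N) s -> spanned N (word s).
Proof.
move=> si sN; rewrite -[word s]addr0 -[word s]scale1r.
by apply: spanned_cons => //; exact: spanned0.
Qed.

Lemma spanned_sum N (I : Type) (r : seq I) (P : pred I) (G : I -> L) :
  (forall i, P i -> spanned N (G i)) -> spanned N (\sum_(i <- r | P i) G i).
Proof. by move=> NG; apply: big_ind => //; [constructor|exact: spannedD]. Qed.

Lemma spanned_leq N M f : (N <= M)%N -> spanned N f -> spanned M f.
Proof.
move=> NM; elim=> [|c s h si sN _ IH]; constructor => //.
by apply: sub_all sN => x /= xN; apply: leq_trans NM.
Qed.

Lemma spanned0_const f : spanned 0 f -> exists c : F, f = c *: 1.
Proof.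
elim=> [|c s h si sN _ [d ->]]; first by exists 0; rewrite scale0r.
case: s si sN => [|x s]; first by exists (c + d); rewrite scalerDl.
by rewrite is_intpart_cons lt0n /= leqn0 => /andP[/negPf ->].
Qed.

Lemma spanned_jing N f : spanned N f -> spanned N (H N f).
Proof.
case: N => [/spanned0_const[c ->]|N].
  rewrite linearZ /= jing1 //; apply: spannedZ.
  by apply: (@spanned_word _ [::]).
elim=> [|c s h si sN _ IH]; first by rewrite linear0; constructor.
rewrite linearP /=; apply: (@spanned_cons _ c (N.+1 :: s)) => //=.
  by rewrite is_intpart_cons /= sN.
by rewrite leqnn.
Qed.

Lemma spanned_iter_jing N m f : spanned N f -> spanned N (iter m (H N) f).
Proof. by move=> Nf; elim: m => //= m; apply: spanned_jing. Qed.

Lemma intpart_block N s : is_intpart s -> all (leq^~ N.+1) s ->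
  exists m s', [/\ s = nseq m N.+1 ++ s', is_intpart s' & all (leq^~ N) s'].
Proof.
elim: s => [|x s IHs] /=; first by exists 0%N, [::].
move=> xsi /andP[]; have := xsi; rewrite is_intpart_cons => /and3P[x0 xs si].
rewrite leq_eqVlt => /orP[/eqP xN|xN] sN.
  have [m [s' [-> s'i s'N]]] := IHs si sN.
  by exists m.+1, s'; rewrite xN.
exists 0%N, (x :: s); split=> //=; rewrite -ltnS xN.
by apply: sub_all xs => y /= yx; apply: leq_trans yx _.
Qed.

Lemma spanned_block_ind N (P : L -> Prop) :
  P 0 -> (forall f g, P f -> P g -> P (f + g)) -> (forall c f, P f -> P (c *: f)) ->
  (forall m f, spanned N f -> P (iter m (H N.+1) f)) ->
  forall f, spanned N.+1 f -> P f.
Proof.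
move=> P0 PD PZ Pb f; elim=> // c s h si sN _ Ph; apply: PD => //; apply: PZ.
have [m [s' [-> s'i s'N]]] := intpart_block si sN.
by rewrite word_nseq; apply: Pb; apply: spanned_word.
Qed.

Lemma emul_is_linear k j : linear (@emul F L k j).
Proof.
move=> c f g; rewrite /emul; case: ifP => _; last by rewrite scaler0 addr0.
by rewrite mulrDr scalerAr.
Qed.
HB.instance Definition _ k j :=
  GRing.isLinear.Build F L L _ (@emul F L k j) (emul_is_linear k j).

Lemma dsub_is_linear k j : linear (@dsub F L t k j).
Proof.
move=> c f g; rewrite /dsub; case: ifP => _; last by rewrite scaler0 addr0.
by rewrite linearP scalerDr !scalerA mulrC.
Qed.
HB.instance Definition _ k j :=
  GRing.isLinear.Build F L L _ (@dsub F L t k j) (dsub_is_linear k j).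

Lemma emul_iter_jing N k j m f :
  emul k j (iter m (H N) f) =
  \sum_(i < m.+1) tbin t m i *: iter i (H N.+1) (iter (m - i) (H N) (emul k (j + i) f)).
Proof.
apply: (straighten_up t_generic) => [i g|g]; first exact: emul_jing.
exact: jing_straighten.
Qed.

Lemma dsub_iter_jing N k j m f :
  dsub t k j (iter m (H N.+1) f) =
  \sum_(i < m.+1) tbin t m i *: iter (m - i) (H N.+1) (iter i (H N) (dsub t k (j + i) f)).
Proof.
apply: (straighten_dn t_generic) => [i g|g]; first exact: dsub_jing.
exact: jing_straighten.
Qed.

Lemma spanned_he k : spanned 1 (he L k).
Proof.
have -> : he L k = (tfact t k)^-1 *: word (nseq k 1%N).
  by rewrite word_ones // scalerA mulVf ?scale1r // tfact_neq0.
apply/spannedZ/spanned_word; last by apply/allP => x /nseqP[->].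
by elim: k => // k IHk; rewrite is_intpart_cons IHk andbT /=; apply/allP => x /nseqP[->].
Qed.

(** Straightening past a block of [N.+1] creates operators with index at most [N.+2], already in
    decreasing order; at the bottom, [e_k] is a multiple of the word of [k] ones. *)
Lemma spanned_emul N k j f : spanned N f -> spanned N.+1 (emul k j f).
Proof.
elim: N k j f => [|N IHN] k j f.
  case/spanned0_const => c ->; rewrite linearZ /=; apply: spannedZ.
  by rewrite /emul; case: ifP => _; [rewrite mulr1; apply: spanned_he|constructor].
elim/spanned_block_ind => {f} [|f g|c f|m f Nf].
- by rewrite linear0; constructor.
- by rewrite linearD; apply: spannedD.
- by rewrite linearZ; apply: spannedZ.
rewrite emul_iter_jing; apply: spanned_sum => i _; apply/spannedZ/spanned_iter_jing.
by apply: spanned_leq (leqnSn _) _; apply/spanned_iter_jing/IHN.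
Qed.

Lemma dshift1 k : dshift t k (1 : L) = (k == 0)%N%:R.
Proof. by rewrite /dshift /shiftc rmorph1 coef1. Qed.

Lemma spanned_dsub N k j f : spanned N f -> spanned N (dsub t k j f).
Proof.
elim: N k j f => [|N IHN] k j f.
  case/spanned0_const => c ->; rewrite linearZ /=; apply: spannedZ.
  rewrite /dsub; case: ifP => _; last by constructor.
  apply: spannedZ; rewrite dshift1; case: eqP => _; last by constructor.
  by apply: (@spanned_word _ [::]).
elim/spanned_block_ind => {f} [|f g|c f|m f Nf].
- by rewrite linear0; constructor.
- by rewrite linearD; apply: spannedD.
- by rewrite linearZ; apply: spannedZ.
rewrite dsub_iter_jing; apply: spanned_sum => i _; apply/spannedZ/spanned_iter_jing.
by apply: spanned_leq (leqnSn _) _; apply/spanned_iter_jing/IHN.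
Qed.

(** The elements whose multiplication preserves the span form a subalgebra. It contains every [e_k]
    by [spanned_emul], hence every power sum by Newton's recurrence. *)
Lemma spanned_full f : exists N, spanned N f.
Proof.
pose stable (g : L) := forall h, (exists N, spanned N h) -> exists N, spanned N (g * h).
suff sf : stable f.
  by rewrite -[f]mulr1; apply: sf; exists 0%N; apply: (@spanned_word _ [::]).
have stD g h : stable g -> stable h -> stable (g + h).
  move=> sg sh x xs; have [N Ng] := sg x xs; have [M Mh] := sh x xs.
  exists (maxn N M); rewrite mulrDl.
  by apply: spannedD; [apply: spanned_leq Ng|apply: spanned_leq Mh]; rewrite ?leq_maxl ?leq_maxr.
have stZ c g : stable g -> stable (c *: g).
  by move=> sg x /sg[N Ng]; exists N; rewrite -scalerAl; apply: spannedZ.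
have stM g h : stable g -> stable h -> stable (g * h).
  by move=> sg sh x xs; rewrite -mulrA; apply/sg/sh.
have st1 : stable 1 by move=> x; rewrite mul1r.
have ste k : stable (he L k).
  move=> x [N Nx]; exists N.+1.
  by have := spanned_emul k 0 Nx; rewrite /emul subn0.
elim/psa_ind: f => // [c|r r0]; first exact: stZ.
elim/ltn_ind: r r0 => -[//|r] IHr _.
have [_ /(_ r)] := he_is_exp L char0.
rewrite big_ord_recr /= subnn he0 mulr1 => e.
have -> : pwr L r.+1 = (-1) ^+ r *: (r.+1%:R *: he L r.+1 +
   (-1) *: \sum_(i < r) (-1) ^+ i *: pwr L i.+1 * he L (r - i)).
  rewrite scaler_nat e scaleN1r addrAC subrr add0r scalerA -expr2 sqrr_sign.
  by rewrite scale1r.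
apply: (stZ); apply: (stD); first exact/stZ/ste.
apply: (stZ); apply: (big_ind stable) => [||i _] //.
  by rewrite -(scale0r 1); apply: stZ.
by apply: (stM) => //; apply: stZ; apply: IHr => //; rewrite ltnS.
Qed.

Lemma word_expansion f : exists r : seq (F * seq nat),
  all (fun x => is_intpart x.2) r /\ f = \sum_(x <- r) x.1 *: word x.2.
Proof.
have [N] := spanned_full f; elim=> [|c s h si sN _ [r [ri ->]]].
  by exists [::]; rewrite big_nil.
by exists ((c, s) :: r); rewrite /= si big_cons.
Qed.

(** A chosen expansion defines the map; independence ([PsiE]) makes its value the same for any other
    expansion, hence linear. *)
Lemma word_functional (V : lmodType F) (w : seq nat -> V) :
  { Psi : {linear L -> V} | forall s, is_intpart s -> Psi (word s) = w s }.
Proof.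
pose rep f := sval (cid (word_expansion f)).
have repi f : all (fun x => is_intpart x.2) (rep f).
  by rewrite /rep; case: cid => r [].
have repE f : f = \sum_(x <- rep f) x.1 *: word x.2.
  by rewrite /rep; case: cid => r [].
pose Psi f := \sum_(x <- rep f) x.1 *: w x.2.
have PsiE r : all (fun x => is_intpart x.2) r ->
    Psi (\sum_(x <- r) x.1 *: word x.2) = \sum_(x <- r) x.1 *: w x.2.
  move=> ri; set f := \sum_(x <- r) _.
  apply/eqP; rewrite -subr_eq0; apply/eqP.
  have negE (U : lmodType F) (v : seq nat -> U) :
     \sum_(x <- rep f ++ [seq (- x.1, x.2) | x <- r]) x.1 *: v x.2 =
     \sum_(x <- rep f) x.1 *: v x.2 - \sum_(x <- r) x.1 *: v x.2.
    rewrite big_cat big_map /=; congr (_ + _); rewrite -sumrN.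
    by apply: eq_bigr => x _; rewrite scaleNr.
  rewrite -negE; apply: (@word_indep 0%N).
    by rewrite all_cat repi all_map.
  by rewrite negE -repE subrr => n _; rewrite rmorph0.
have Psi_lin : linear Psi.
  move=> c f g; pose r := [seq (c * x.1, x.2) | x <- rep f] ++ rep g.
  have rE (U : lmodType F) (v : seq nat -> U) : \sum_(x <- r) x.1 *: v x.2 =
      c *: (\sum_(x <- rep f) x.1 *: v x.2) + \sum_(x <- rep g) x.1 *: v x.2.
    rewrite big_cat big_map /= scaler_sumr; congr (_ + _).
    by apply: eq_bigr => x _; rewrite scalerA.
  rewrite {1}(repE f) {1}(repE g) -rE PsiE ?rE //.
  by rewrite all_cat all_map !repi.
pose PsiL := GRing.isLinear.Build F L V _ Psi Psi_lin.
pose Psi' : {linear L -> V} := HB.pack Psi PsiL.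
exists Psi' => s si; have := PsiE [:: (1, s)].
by rewrite !big_seq1 /= si !scale1r; apply.
Qed.

End Basis.

(** * Products over multiplicities, factored along one block *)

Section BlockProducts.
Variables (R : comNzRingType) (g : nat -> R).

Lemma block_prod (T : eqType) (x : T) m (s : seq T) : g 0%N = 1 -> x \notin s ->
  \prod_(i <- undup (nseq m x ++ s)) g (count_mem i (nseq m x ++ s)) =
  g m * \prod_(i <- undup s) g (count_mem i s).
Proof.
move=> g0 xs; case: m => [|m]; first by rewrite g0 mul1r.
have -> : undup (nseq m.+1 x ++ s) = x :: undup s.
  elim: m => [|m IHm]; first by rewrite /= (negPf xs).
  rewrite -[LHS]/(if x \in nseq m.+1 x ++ s then undup (nseq m.+1 x ++ s)
    else x :: undup (nseq m.+1 x ++ s)) IHm.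
  by rewrite mem_cat mem_nseq eqxx.
rewrite big_cons count_cat count_nseq /= eqxx mul1n (count_memPn xs) addn0.
congr (_ * _); apply: eq_big_seq => i; rewrite mem_undup => is_.
rewrite -/(nseq m.+1 x ++ s) count_cat count_nseq /=.
by case: eqP is_ xs => [<- ->|].
Qed.

End BlockProducts.

(** * The Hall-Littlewood scalar product and the adjoint of e_k *)

Section HallForm.
Variables (F : fieldType) (L : power_sum_algebra F) (t : F).
Hypothesis char0 : [pchar F] =i pred0.
Hypothesis t_generic : forall r : nat, (0 < r)%N -> t ^+ r != 1.
Implicit Types (f g : L) (s : seq nat).

Local Notation H := (@jing F L t).
Local Notation word := (@word F L t).
Local Notation spanned := (@spanned F L t).

Definition functional (V : lmodType F) (w : seq nat -> V) : {linear L -> V} :=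
  sval (word_functional L char0 t_generic w).

Lemma functionalE (V : lmodType F) (w : seq nat -> V) s :
  is_intpart s -> functional w (word s) = w s.
Proof. by rewrite /functional; case: word_functional => Psi PsiE /= /PsiE. Qed.

Definition coordQ s : {linear L -> F^o} := functional (V := F^o) (fun u => (u == s)%:R).

Lemma coordQ_word s u : is_intpart u -> coordQ s (word u) = (u == s)%:R.
Proof. exact: functionalE. Qed.

(** The scalar product is imposed on the basis of words, so that [P] and [Q] are dual at once; what
    has to be proved is its compatibility with multiplication. *)
Definition hform f : {linear L -> F^o} := 
  functional (V := F^o) (fun s => hl_b t s * coordQ s f).

Lemma hform_word f s : is_intpart s -> hform f (word s) = hl_b t s * coordQ s f.
Proof. exact: functionalE. Qed.

Lemma linear_ext (V : lmodType F) (u v : {linear L -> V}) :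
  (forall s, is_intpart s -> u (word s) = v (word s)) -> u =1 v.
Proof.
move=> uv f; have [N Nf] := spanned_full char0 t_generic f.
elim: Nf => [|c s h si _ _ IH]; first by rewrite !linear0.
by rewrite !linearP /= IH uv.
Qed.

Lemma hform_linearl c f1 f2 g : hform (c *: f1 + f2) g = c * hform f1 g + hform f2 g.
Proof.
have [N Ng] := spanned_full char0 t_generic g.
elim: Ng => [|d s h si _ _ IH]; first by rewrite !linear0 mulr0 addr0.
rewrite !linearP /= IH !hform_word // linearP /= mulrDr !mulrDr.
by rewrite /GRing.scale /=; ring.
Qed.

Lemma hform_sym f g : hform f g = hform g f.
Proof.
have [N Nf] := spanned_full char0 t_generic f.
have [M Mg] := spanned_full char0 t_generic g.
have h0 h : hform 0 h = 0.
  by have := hform_linearl 1 0 0 h; rewrite scaler0 addr0 mul1r => /eqP;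
     rewrite -subr_eq0 opprD addrA subrr sub0r oppr_eq0 => /eqP.
elim: Nf => [|d s h si _ _ IH]; first by rewrite linear0 h0.
rewrite hform_linearl linearP /= IH; congr (_ + _).
elim: Mg {IH} => [|d' s' h' si' _ _ IH]; first by rewrite linear0 h0 mulr0 [RHS]mulr0.
rewrite hform_linearl linearP /= mulrDr IH [RHS]mulrDr; congr (_ + _).
rewrite !hform_word // !coordQ_word // eq_sym /GRing.scale /=.
by case: eqP => [->|_]; rewrite ?mulr0 ?mulr1 //; ring.
Qed.

Lemma hform0l g : hform 0 g = 0.
Proof. by rewrite hform_sym linear0. Qed.
Lemma hformDl f1 f2 g : hform (f1 + f2) g = hform f1 g + hform f2 g.
Proof. by rewrite !(hform_sym _ g) linearD. Qed.
Lemma hformZl c f g : hform (c *: f) g = c * hform f g.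
Proof. by rewrite !(hform_sym _ g) linearZ. Qed.
Lemma hformZr c f g : hform f (c *: g) = c * hform f g.
Proof. by rewrite linearZ. Qed.
Lemma hform_suml (I : Type) (r : seq I) (G : I -> L) g :
  hform (\sum_(i <- r) G i) g = \sum_(i <- r) hform (G i) g.
Proof. by rewrite hform_sym linear_sum; apply: eq_bigr => i _; rewrite hform_sym. Qed.
Lemma hform_sumr (I : Type) (r : seq I) (G : I -> L) g :
  hform g (\sum_(i <- r) G i) = \sum_(i <- r) hform g (G i).
Proof. by rewrite linear_sum. Qed.

Lemma is_intpart_block N m s : is_intpart s -> all (leq^~ N) s ->
  is_intpart (nseq m N.+1 ++ s) && all (leq^~ N.+1) (nseq m N.+1 ++ s).
Proof.
move=> si sN; elim: m => [|m /andP[IH1 IH2]] /=.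
  by rewrite si; apply: sub_all sN => x /= /leqW.
by rewrite is_intpart_cons IH1 IH2 leqnn.
Qed.

Lemma notin_block N s : all (leq^~ N) s -> N.+1 \notin s.
Proof. by move=> sN; apply/negP => /(allP sN) /=; rewrite ltnn. Qed.

Lemma eq_block N m m' s s' : all (leq^~ N) s -> all (leq^~ N) s' ->
  (nseq m N.+1 ++ s == nseq m' N.+1 ++ s') = (m == m') && (s == s').
Proof.
move=> sN s'N; apply/eqP/andP => [e|[/eqP-> /eqP->]] //.
have mm : m = m'.
  have := congr1 (count_mem N.+1) e; rewrite !count_cat !count_nseq /= eqxx !mul1n.
  by rewrite !(count_memPn (notin_block _)) // !addn0.
by move: e; rewrite mm => /eqP; rewrite eqseq_cat // eqxx.
Qed.

Lemma iter_jingD r n f g : iter n (H r) (f + g) = iter n (H r) f + iter n (H r) g.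
Proof. by elim: n => //= n ->; rewrite linearD. Qed.
Lemma iter_jingZ r n c f : iter n (H r) (c *: f) = c *: iter n (H r) f.
Proof. by elim: n => //= n ->; rewrite linearZ. Qed.
Lemma iter_jing0 r n : iter n (H r) 0 = 0.
Proof. by elim: n => //= n ->; rewrite linear0. Qed.

(** Since [b_la] is a product over distinct parts, the form factors along the block of largest
    parts. *)
Lemma hform_block N m m' f g : spanned N f -> spanned N g ->
  hform (iter m (H N.+1) f) (iter m' (H N.+1) g) =
  (m == m')%:R * tfact t m * hform f g.
Proof.
move=> Nf Ng; elim: Nf => [|c s h si sN _ IH]; first by rewrite iter_jing0 !hform0l mulr0.
rewrite iter_jingD iter_jingZ !hformDl !hformZl IH mulrDr; congr (_ + _).
rewrite [RHS]mulrCA; congr (_ * _).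
elim: Ng {IH} => [|c' s' h' si' s'N _ IH]; first by rewrite iter_jing0 !linear0 mulr0.
rewrite iter_jingD iter_jingZ !linearD !hformZr IH mulrDr; congr (_ + _).
rewrite [RHS]mulrCA; congr (_ * _); rewrite -!word_nseq.
have /andP[i1 _] := is_intpart_block m si sN.
have /andP[i2 _] := is_intpart_block m' si' s'N.
rewrite !hform_word // !coordQ_word // eq_block //.
rewrite /hl_b (@block_prod _ (tfact t)) ?tfact0 ?notin_block //.
by case: eqP => [->|_] /=; rewrite ?mul1r ?mulrA // !mul0r mulr0.
Qed.

Lemma hform_block0 N m f g : spanned N f -> spanned N g ->
  hform f (iter m (H N.+1) g) = (m == 0)%N%:R * hform f g.
Proof.
by move=> Nf Ng; rewrite (@hform_block N 0 m f g) // tfact0 mulr1 eq_sym.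
Qed.

(** The adjoint of [H_{N+1}^a] removes [a] operators from a block of [m], with factor
    [(t;t)_m / (t;t)_{m-a}]; here [f] may itself contain parts [N.+1]. *)
Lemma hform_strip N a m f g : spanned N.+1 f -> spanned N g ->
  hform (iter a (H N.+1) f) (iter m (H N.+1) g) * tfact t (m - a) =
  (a <= m)%N%:R * tfact t m * hform f (iter (m - a) (H N.+1) g).
Proof.
move=> + Ng; elim/spanned_block_ind => {f} [|f1 f2 IH1 IH2|c f IH|p f Nf].
- by rewrite iter_jing0 !hform0l mulr0 mul0r.
- by rewrite iter_jingD !hformDl mulrDl IH1 IH2 mulrDr.
- by rewrite iter_jingZ !hformZl -[in LHS]mulrA IH mulrCA.
rewrite -iterD !hform_block //; case: (eqVneq (a + p)%N m) => [<-|apm].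
  by rewrite addKn leq_addr !eqxx !mul1r; ring.
rewrite !mul0r; case: (leqP a m) => [am|_]; last by rewrite !mul0r.
by rewrite -(eqn_add2l a) subnKC // (negPf apm) !mul0r mulr0.
Qed.

(** The core of the induction for adjointness: after the blocks of the largest part have been
    matched, blocks of [N.+1] remain on both sides. Stripping them reduces to the adjointness
    assumed for [f] with parts at most [N]. *)
Lemma hform_adjoint_step N k q n p m f g : spanned N f -> spanned N g ->
  (forall h, spanned N.+1 h -> hform (emul k q f) h = (-1) ^+ k * hform f (dsub t k q h)) ->
  tbin t n p * tfact t p * hform (iter (n - p) (H N.+1) (emul k q f)) (iter m (H N.+1) g) =
  (-1) ^+ k * hform (iter n (H N.+1) f)
                    (iter p (H N.+1) (dsub t k q (iter m (H N.+1) g))).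
Proof.
move=> Nf Ng IH.
have Ne : spanned N.+1 (emul k q f) by exact: spanned_emul.
rewrite (dsub_iter_jing char0 t_generic).
have -> : iter p (H N.+1) (\sum_(i < m.+1) tbin t m i *: iter (m - i) (H N.+1)
     (iter i (H N) (dsub t k (q + i) g))) =
   \sum_(i < m.+1) tbin t m i *: iter (p + (m - i)) (H N.+1)
     (iter i (H N) (dsub t k (q + i) g)).
  elim: (m.+1) => [|u IHu]; first by rewrite !big_ord0 iter_jing0.
  by rewrite !big_ord_recr /= iter_jingD IHu iter_jingZ iterD.
have Nd i : spanned N (iter i (H N) (dsub t k (q + i) g)).
  exact/spanned_iter_jing/spanned_dsub.
rewrite hform_sumr.
under eq_bigr => i _ do rewrite hformZr hform_block //.
have [np|pn] := ltnP n p.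
  rewrite tbin_gt // !mul0r big1 ?mulr0 // => i _.
  case: eqP => [e|_]; last by rewrite !mul0r mulr0.
  by move: np; rewrite e ltnNge leq_addr.
have [mnp|npm] := ltnP m (n - p).
  have := @hform_strip N (n - p) m _ _ Ne Ng.
  rewrite leqNgt mnp !mul0r => /eqP; rewrite mulf_eq0 (negPf (tfact_neq0 t_generic _)).
  rewrite orbF => /eqP ->; rewrite mulr0 big1 ?mulr0 // => i _.
  case: eqP => [e|_]; last by rewrite !mul0r mulr0.
  by move: mnp; rewrite e addKn ltnNge leq_subr.
(* The only index for which the block [p + (m - i)] on the right has the length [n] of the block on
   the left. *)
pose u := (m - (n - p))%N.
have um : (u < m.+1)%N by rewrite ltnS leq_subr.
have nE : n = (p + (m - u))%N by rewrite /u subKn // subnKC.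
have muE : (m - u = n - p)%N by rewrite /u subKn.
rewrite (bigD1 (Ordinal um)) //= big1 ?addr0; last first.
  move=> i iu; case: eqP => [e|_]; last by rewrite !mul0r mulr0.
  case/eqP: iu; apply/val_inj => /=; move: e; rewrite nE => /addnI e.
  by rewrite -(subKn (ltnSE (ltn_ord i))) -e subKn // -ltnS.
rewrite -nE eqxx mul1r.
apply: (@mulIf _ (tfact t u * tfact t (n - p))); first by rewrite mulf_neq0 ?tfact_neq0.
have st := @hform_strip N (n - p) m _ _ Ne Ng.
rewrite npm mul1r -/u in st.
rewrite IH in st; last exact/spanned_iter_jing/spanned_leq/Ng.
move: st; rewrite (dsub_iter_jing char0 t_generic) hform_sumr.
under eq_bigr => i _ do rewrite hformZr hform_block0 //.
rewrite big_ord_recr /= tbinn // mul1r subnn eqxx mul1r big1 ?add0r; last first.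
  by move=> i _; rewrite subn_eq0 leqNgt ltn_ord mul0r mulr0.
set X := hform f _; set Y := hform _ _ => st.
have b1 := tbinE t_generic pn.
have b2 := tbinE t_generic (ltnSE um); rewrite muE in b2.
transitivity (tfact t n * (Y * tfact t u)).
  by rewrite -b1; ring.
by rewrite st -b2; ring.
Qed.

(** Both sides are straightened: [e_k] raises some parts of [f], the dual shift lowers some parts of
    [g], and orthogonality of blocks leaves one term on each side. The bound for [g] exceeds that
    for [f] by one because [e_k] raises parts by at most one. *)
Lemma hform_adjoint_span N k j f g : spanned N f -> spanned N.+1 g ->
  hform (emul k j f) g = (-1) ^+ k * hform f (dsub t k j g).
Proof.
elim: N k j f g => [|N IHN] k j f g.
  case/spanned0_const => c ->; rewrite linearZ !hformZl mulrCA => sg.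
  congr (_ * _); elim/spanned_block_ind: sg => {g} [|g1 g2 IH1 IH2|d g IH|p g].
  - by rewrite !linear0 mulr0.
  - by rewrite !linearD mulrDr IH1 IH2.
  - by rewrite !linearZ /= IH mulrCA.
  case/spanned0_const => d ->; rewrite iter_jingZ !linearZ /= mulrCA.
  congr (_ * _).
  rewrite (dsub_iter_jing char0 t_generic) hform_sumr.
  have s1 : spanned 0 (1 : L) by apply: (@spanned_word _ _ _ _ [::]).
  have sd i : spanned 0 (iter i (H 0) (dsub t k (j + i) 1)).
    exact/spanned_iter_jing/spanned_dsub.
  under eq_bigr => i _ do rewrite hformZr hform_block0 //.
  rewrite big_ord_recr /= tbinn // mul1r subnn eqxx mul1r big1 ?add0r; last first.
    by move=> i _; rewrite subn_eq0 leqNgt ltn_ord mul0r mulr0.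
  have h1 : hform 1 1 = 1.
    rewrite (@hform_word 1 [::]) // (@coordQ_word [::] [::]) // eqxx mulr1.
    by rewrite /hl_b big_nil.
  have iter01 i : iter i (H 0) 1 = 1 by elim: i => //= i ->; rewrite jing1.
  have dE : hform 1 (iter p (H 0) (dsub t k (j + p) 1)) =
      (j + p == k)%N%:R * (-1) ^+ k.
    rewrite /dsub dshift1; case: (ltngtP (j + p) k) => [jk|jk|->].
    - by rewrite subn_eq0 leqNgt jk scaler0 iter_jing0 linear0 mul0r.
    - by rewrite iter_jing0 linear0 mul0r.
    - by rewrite subnn iter_jingZ hformZr iter01 h1 mulr1 mul1r.
  rewrite dE mulrCA -expr2 sqrr_sign mulr1 /emul; case: leqP => [jk|kj]; last first.
    by rewrite hform0l gtn_eqF // ltn_addr.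
  rewrite mulr1.
  have -> : he L (k - j) = (tfact t (k - j))^-1 *: iter (k - j) (H 1) 1.
    by rewrite -[1]/(word [::]) -word_nseq cats0 word_ones // scalerA mulVf ?scale1r // tfact_neq0.
  rewrite hformZl (@hform_block 0) // h1 mulr1 mulrCA mulVf ?mulr1 ?tfact_neq0 //.
  by rewrite -(eqn_add2l j) subnKC // eq_sym.
move=> sf; elim/spanned_block_ind: sf g => {f} [|f1 f2 IH1 IH2|c f IH|n f Nf] g sg.
- by rewrite linear0 !hform0l mulr0.
- by rewrite linearD !hformDl mulrDr IH1 // IH2.
- by rewrite linearZ /= !hformZl IH // mulrCA.
elim/spanned_block_ind: sg => {g} [|g1 g2 IH1 IH2|c g IH|p g sg].
- by rewrite !linear0 mulr0.
- by rewrite !linearD mulrDr IH1 IH2.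
- by rewrite !linearZ /= IH mulrCA.
rewrite (emul_iter_jing char0 t_generic) hform_suml.
have Ne i : spanned N.+1 (iter (n - i) (H N.+1) (emul k (j + i) f)).
  exact/spanned_iter_jing/spanned_emul.
under eq_bigr => i _ do rewrite hformZl hform_block //.
rewrite (dsub_iter_jing char0 t_generic) hform_sumr.
have Nd i : spanned N.+1 (iter i (H N.+1) (dsub t k (j + i) g)).
  exact/spanned_iter_jing/spanned_dsub.
have Nf1 : spanned N.+1 (iter n (H N.+1) f).
  exact/spanned_iter_jing/spanned_leq/Nf.
under [in RHS]eq_bigr => i _ do rewrite hformZr hform_block0 //.
rewrite [in RHS]big_ord_recr /= tbinn // mul1r subnn eqxx mul1r.
rewrite [in RHS]big1 ?add0r; last first.
  by move=> i _; rewrite subn_eq0 leqNgt ltn_ord mul0r mulr0.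
transitivity (tbin t n p * tfact t p *
    hform (iter (n - p) (H N.+1) (emul k (j + p) f)) g).
  case: (ltnP p n.+1) => [pn|np]; last first.
    rewrite tbin_gt // !mul0r big1 // => i _.
    by rewrite ltn_eqF ?mul0r ?mulr0 // (leq_trans (ltn_ord i)).
  rewrite (bigD1 (Ordinal pn)) //= eqxx mul1r mulrA big1 ?addr0 // => i ip.
  rewrite -val_eqE /= in ip.
  by rewrite (negPf ip) !mul0r mulr0.
elim/spanned_block_ind: sg => {g Nd} [|g1 g2 IH1 IH2|c g IH|m g sg].
- by rewrite !linear0 iter_jing0 linear0 !mulr0.
- by rewrite !linearD iter_jingD linearD /= !mulrDr IH1 IH2.
- by rewrite !linearZ /= iter_jingZ hformZr [LHS]mulrCA IH mulrCA.
apply: hform_adjoint_step => // h sh.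
exact: IHN.
Qed.

Lemma hform_adjoint k f g : hform (he L k * f) g = (-1) ^+ k * hform f (dshift t k g).
Proof.
have [N Nf] := spanned_full char0 t_generic f.
have [M Mg] := spanned_full char0 t_generic g.
have := @hform_adjoint_span (maxn N M) k 0 f g.
rewrite /emul /dsub /= !subn0 expr0 scale1r; apply.
  by apply: spanned_leq Nf; rewrite leq_maxl.
by apply: spanned_leq Mg; rewrite leqW // leq_maxr.
Qed.

End HallForm.

(** * Grading, constant term, and the dual shift at a letter *)

Section Homogeneity.
Variables (F : fieldType) (L : power_sum_algebra F) (t : F).
Hypothesis char0 : [pchar F] =i pred0.
Hypothesis t_generic : forall r : nat, (0 < r)%N -> t ^+ r != 1.
Implicit Types (f g : L) (s : seq nat).

Local Notation H := (@jing F L t).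
Local Notation word := (@word F L t).
Local Notation coordQ := (coordQ L char0 t_generic).

Inductive graded : nat -> L -> Prop :=
| graded1 : graded 0 1
| graded0 d : graded d 0
| gradedD d f g : graded d f -> graded d g -> graded d (f + g)
| gradedZ d c f : graded d f -> graded d (c *: f)
| gradedP r d f : (0 < r)%N -> graded d f -> graded (r + d) (pwr L r * f).

Lemma gradedM d e f g : graded d f -> graded e g -> graded (d + e) (f * g).
Proof.
move=> df eg; elim: df => [|d'|d' f1 f2 _ IH1 _ IH2|d' c h _ IH|r d' h r0 _ IH].
- by rewrite mul1r.
- by rewrite mul0r; apply: graded0.
- by rewrite mulrDl; apply: gradedD.
- by rewrite -scalerAl; apply: gradedZ.
- by rewrite -addnA -mulrA; apply: gradedP.
Qed.

Lemma graded_sum d (I : Type) (r : seq I) (P : pred I) (G : I -> L) :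
  (forall i, P i -> graded d (G i)) -> graded d (\sum_(i <- r | P i) G i).
Proof. by move=> dG; apply: big_ind => //; [exact: graded0|exact: gradedD]. Qed.

Lemma graded_hq m : graded m (hq L t m).
Proof.
elim/ltn_ind: m => -[_|m IHm]; first exact: graded1.
have [_ /(_ m) e] := hq_is_exp L t char0.
have -> : hq L t m.+1 = m.+1%:R^-1 *: (hq L t m.+1 *+ m.+1).
  rewrite -scaler_nat scalerA mulVf ?scale1r //.
  by move/pcharf0P: char0 => ->.
rewrite e; apply/gradedZ/graded_sum => i _; rewrite -scalerAl; apply: gradedZ.
have im : (i <= m)%N by rewrite -ltnS.
rewrite -{1}(subnKC im) -addSn; apply: gradedP => //.
by apply: IHm; rewrite ltnS leq_subr.
Qed.

Lemma graded_rem_var d f m : graded d f ->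
  ((m <= d)%N -> graded (d - m) (rem_var L f)`_m) /\
  ((d < m)%N -> (rem_var L f)`_m = 0).
Proof.
move=> df; elim: df m => [|d'|d' f1 f2 _ IH1 _ IH2|d' c h _ IH|r d' h r0 _ IH] m.
- by rewrite rmorph1 coef1; split; case: m => // _; exact: graded1.
- by rewrite rmorph0 coef0; split=> // _; exact: graded0.
- have [a1 b1] := IH1 m; have [a2 b2] := IH2 m.
  rewrite rmorphD coefD; split=> dm; first by apply: gradedD; auto.
  by rewrite b1 // b2 // addr0.
- have [a1 b1] := IH m; rewrite /rem_var shiftZ coefCM mulr_algl.
  split=> dm; first by apply: gradedZ; auto.
  by rewrite b1 // scaler0.
- have [a1 b1] := IH m; have [a2 b2] := IH (m - r)%N.
  rewrite rmorphM rem_var_pwr // mulrBl coefB coefCM coefXnM; split=> dm.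
    apply: gradedD.
      case: (leqP m d') => [md|dm']; first by rewrite -addnBA //; apply: gradedP; auto.
      by rewrite b1 // mulr0; apply: graded0.
    case: ifP => [_|/negbT]; first by rewrite oppr0; apply: graded0.
    rewrite -leqNgt => rm; rewrite -scaleN1r; apply: gradedZ.
    have -> : (r + d' - m = d' - (m - r))%N by rewrite subnBA // addnC.
    by apply: a2; rewrite leq_subLR.
  rewrite b1 ?(leq_ltn_trans _ dm) ?leq_addl // mulr0 sub0r ltnNge.
  rewrite (leq_trans (leq_addr d' r) (ltnW dm)) /= b2 ?oppr0 //.
  by rewrite ltn_subRL.
Qed.

Lemma graded_jing r d f : graded d f -> graded (r + d) (H r f).
Proof.
move=> df; apply: graded_sum => m _; have [a b] := graded_rem_var m df.
case: (leqP m d) => [md|dm]; last by rewrite b // mulr0; apply: graded0.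
have -> : (r + d = (r + m) + (d - m))%N by rewrite -addnA subnKC.
by apply: gradedM; [exact: graded_hq|exact: a].
Qed.

Lemma graded_word s : graded (sumn s) (word s).
Proof. by elim: s => [|r s IHs]; [exact: graded1|exact: graded_jing]. Qed.

(** The morphism [p_r -> p_r z^r] multiplies an element of degree [d] by [z^d]; applied to both [f]
    and its expansion in words, it separates the degrees. *)
Lemma graded_coordQ d f s : graded d f -> sumn s != d -> coordQ s f = 0.
Proof.
move=> df sd.
pose deg : {rmorphism L -> {poly L}} :=
  psa_spec L (polyC \o in_alg L) (fun r => (pwr L r)%:P * 'X^r).
have degE e g : graded e g -> deg g = g%:P * 'X^e.
  elim=> [|e'|e' f1 f2 _ IH1 _ IH2|e' c h _ IH|r e' h r0 _ IH].
  - by rewrite rmorph1 expr0 mulr1.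
  - by rewrite rmorph0 mul0r.
  - by rewrite rmorphD IH1 IH2 polyCD mulrDl.
  - by rewrite psa_spec_scale IH /= mulrA -polyCM mulr_algl.
  - by rewrite rmorphM IH psa_spec_pwr // polyCM exprD; ring.
have [r [ri fE]] := word_expansion char0 t_generic f.
have /(congr1 (fun p : {poly L} => coordQ s p`_(sumn s))) := degE _ _ df.
rewrite coefCM coefXn (negPf sd) mulr0 linear0.
rewrite {1}fE rmorph_sum coef_sum linear_sum => e0.
rewrite fE linear_sum -[RHS]e0 big_seq [RHS]big_seq; apply: eq_bigr => x xr.
have xi := allP ri x xr.
rewrite psa_spec_scale /= coefCM (degE _ _ (graded_word _)) coefCM coefXn mulr_algl.
rewrite !linearZ /=; congr (_ * _).
rewrite coordQ_word //; case: (altP (x.2 =P s)) xi => [-> si|xs xi].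
  by rewrite eqxx mulr1 coordQ_word ?eqxx.
case: eqP => _; last by rewrite mulr0 linear0.
by rewrite mulr1 coordQ_word // (negPf xs).
Qed.

Definition aug : {rmorphism L -> F} := psa_spec L idfun (fun=> 0).

Lemma aug_hq m : aug (hq L t m) = (m == 0)%N%:R.
Proof.
have tf : torsion_free F by exact: (torsion_free_lmod (V := F^o) char0).
have h1 := is_exp_rmorph aug (hq_is_exp L t char0).
have h2 : is_exp (fun=> 0) (fun m => (m == 0)%N%:R : F).
  by split=> // i; rewrite mul0rn big1 // => j _; rewrite mul0r.
apply: (is_exp_uniq tf h1 h2) => r r0 /=.
by rewrite psa_spec_scale psa_spec_pwr // mulr0.
Qed.

Lemma aug_word s : is_intpart s -> aug (word s) = (s == [::])%:R.
Proof.
case: s => [_|r s]; first by rewrite rmorph1.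
rewrite is_intpart_cons => /and3P[r0 _ _] /=.
rewrite /jing /pair_hq rmorph_sum big1 // => m _.
by rewrite rmorphM aug_hq addn_eq0 (gtn_eqF r0) mul0r.
Qed.

(** The morphism [p_r -> p_r - a^r/(1-t^r)], obtained by giving the variable of [dual_shift] the
    value [a]. *)
Definition dual_eval (a : F) : {rmorphism L -> L} :=
  horner_eval (a *: 1) \o dual_shift L t.

Lemma dual_evalE a f n : (size (dual_shift L t f) <= n)%N ->
  dual_eval a f = \sum_(k < n) a ^+ k *: dshift t k f.
Proof.
move=> fn; rewrite /= horner_evalE (horner_coef_wide _ fn).
by apply: eq_bigr => k _; rewrite exprZn expr1n mulr_algr.
Qed.

Lemma dual_evalZ a c f : dual_eval a (c *: f) = c *: dual_eval a f.
Proof. by rewrite /= /dual_shift shiftZ horner_evalE hornerCM mulr_algl. Qed.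

Lemma dual_eval_is_linear a : linear (dual_eval a).
Proof. by move=> c f g; rewrite rmorphD dual_evalZ. Qed.

Lemma dual_eval_jing a r f :
  dual_eval a (H r.+1 f) = H r.+1 (dual_eval a f) - a *: H r (dual_eval a f).
Proof.
pose n := maxn (size (dual_shift L t f)) (size (dual_shift L t (H r.+1 f))).
rewrite (@dual_evalE a (H r.+1 f) n.+1); last by rewrite leqW // leq_maxr.
have fE m : (n <= m)%N -> dual_eval a f = \sum_(k < m) a ^+ k *: dshift t k f.
  by move=> nm; apply: dual_evalE; apply: leq_trans nm; rewrite leq_maxl.
rewrite {1}(fE n.+1) // (fE n) // big_ord_recl [in RHS]big_ord_recl.
rewrite !expr0 !scale1r !dshift0 linearD -addrA; congr (_ + _).
rewrite (raddf_sum (H r.+1)) (raddf_sum (H r)) scaler_sumr -sumrB; apply: eq_bigr => k _.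
rewrite /= /bump leq0n add1n dshift_jing // scalerBr !linearZ /=.
by rewrite scalerA exprS.
Qed.

Lemma spanned_dual_eval N a f : spanned t N f -> spanned t N (dual_eval a f).
Proof.
move=> Nf; rewrite (@dual_evalE a f _ (leqnn _)); apply: spanned_sum => k _.
apply: spannedZ; have := spanned_dsub char0 t_generic k 0 Nf.
by rewrite /dsub subn0 expr0 scale1r.
Qed.

HB.instance Definition _ a :=
  GRing.isScalable.Build F L L *:%R (dual_eval a) (dual_evalZ a).

Lemma dual_eval_iter_jing a N m f :
  dual_eval a (iter m (H N.+1) f) =
  \sum_(i < m.+1) (tbin t m i * (- a) ^+ i) *:
     iter (m - i) (H N.+1) (iter i (H N) (dual_eval a f)).
Proof.
(* Putting the power of [-a] into the index makes [dual_eval_jing] an instance of the hypothesis of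
   [straighten_dn]. *)
pose T j g := (- a) ^+ j *: dual_eval a g.
have TH j g : T j (H N.+1 g) = H N.+1 (T j g) + H N (T j.+1 g).
  rewrite /T dual_eval_jing [H N.+1 (_ *: _)]linearZ [H N (_ *: _)]linearZ scalerBr.
  by rewrite scalerA -scaleNr; congr (_ + _ *: _); rewrite exprSr mulrN.
have := @straighten_dn F t t_generic L T (H N.+1) (H N) TH _ m 0 f.
rewrite /T expr0 scale1r => ->; last exact: jing_straighten.
by apply: eq_bigr => i _; rewrite add0n !iter_jingZ scalerA.
Qed.

(* [Phi] is multiplicative over the parts of a partition: adding a part [N]
   multiplies it by [c N]. *)
Definition part_weight (c : nat -> F) (Phi : L -> F) :=
  forall N f, spanned t N f -> Phi (H N f) = c N * Phi f.

Lemma part_weight_iter c (Phi : L -> F) N m f : part_weight c Phi ->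
  spanned t N f -> Phi (iter m (H N) f) = c N ^+ m * Phi f.
Proof.
move=> w Nf; elim: m => [|m IHm]; first by rewrite mul1r.
by rewrite /= w ?IHm ?mulrA -?exprS //; apply: spanned_iter_jing.
Qed.

(** Each term of the expansion is a block of [N.+1] followed by a block of [N], so the weight can be
    read off; these sums become the Rogers-Szegő polynomials. *)
Lemma part_weight_dual_eval c (Phi : {linear L -> F^o}) a N m f : part_weight c Phi ->
  spanned t N f ->
  Phi (dual_eval a (iter m (H N.+1) f)) =
  (\sum_(i < m.+1) tbin t m i * (- a * c N) ^+ i * c N.+1 ^+ (m - i)) *
  Phi (dual_eval a f).
Proof.
move=> w Nf; rewrite dual_eval_iter_jing linear_sum mulr_suml.
apply: eq_bigr => i _; rewrite linearZ /=.
have Na := spanned_dual_eval a Nf.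
rewrite (part_weight_iter _ w) ?(part_weight_iter _ w) //.
  by rewrite exprMn /GRing.scale /=; ring.
by apply: spanned_leq (leqnSn N) _; apply: spanned_iter_jing.
Qed.

End Homogeneity.

(** * A partial fraction identity in finitely many variables *)

Section PartialFractions.
Variables (F : fieldType) (t : F).

Definition lin_prod n (P : pred 'I_n) (c : 'I_n -> F) : {poly F} :=
  \prod_(i | P i) (1 - (c i)%:P * 'X).

Lemma coef_lin1 (c : F) j : (1 - c%:P * 'X)`_j = lin1 c j.
Proof. by rewrite coefB coef1 coefCM coefX /lin1; case: j => [|[|j]] /=; rewrite ?nth_nil; ring. Qed.

Lemma size_lin1 (c : F) : (size (1 - c%:P * 'X)%R <= 2)%N.
Proof.
by apply/leq_sizeP => j; rewrite coef_lin1 /lin1; case: j => [|[|j]] //= _; rewrite nth_nil.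
Qed.

Lemma size_lin_prod n (P : pred 'I_n) c : (size (lin_prod P c) <= #|P|.+1)%N.
Proof.
apply: leq_trans (size_poly_prod_leq _ _) _.
rewrite leq_subLR addnS ltnS -sum1_card -big_split /=.
by apply: leq_sum => i _; exact: size_lin1.
Qed.

Lemma lin_prod_split n (a : 'I_n) c :
  lin_prod predT c = (1 - (c a)%:P * 'X) * lin_prod (predC1 a) c.
Proof. by rewrite /lin_prod (bigD1 a). Qed.

Lemma lin_prod_coef0 n (P : pred 'I_n) c : (lin_prod P c)`_0 = 1.
Proof.
rewrite -horner_coef0 horner_prod big1 // => i _.
by rewrite hornerD hornerN hornerM hornerX mulr0 subr0 hornerC.
Qed.

Lemma coef_lin1M (c : F) (p : {poly F}) j :
  ((1 - c%:P * 'X) * p)`_j.+1 = p`_j.+1 - c * p`_j.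
Proof. by rewrite mulrBl mul1r coefB -mulrA coefCM coefXM. Qed.

Lemma lin_prod_top n (c : 'I_n -> F) : (lin_prod predT c)`_n = \prod_i (- c i).
Proof.
elim: n c => [|n IHn] c; first by rewrite /lin_prod !big_ord0 coef1.
rewrite /lin_prod big_ord_recl [RHS]big_ord_recl coef_lin1M.
have := size_lin_prod predT (c \o lift ord0); rewrite card_ord => sz.
by rewrite [X in X - _](nth_default _ sz) sub0r -(IHn (c \o lift ord0)) mulNr.
Qed.

Lemma is_exp_lin_prod n (c : 'I_n -> F) :
  is_exp (fun r => - \sum_i c i ^+ r) (fun m => (lin_prod predT c)`_m).
Proof.
elim: n c => [|n IHn] c.
  rewrite /lin_prod big_ord0; split=> [|m]; first by rewrite coef1.
  by rewrite coef1 mul0rn big1 // => i _; rewrite big_ord0 oppr0 mul0r.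
apply: (eq_is_exp _ _ (is_exp_conv (is_exp_lin1 (c ord0)) (IHn (c \o lift ord0)))).
  by move=> r _; rewrite big_ord_recl opprD.
move=> m; rewrite /lin_prod big_ord_recl coefM.
by apply: eq_bigr => i _; rewrite coef_lin1.
Qed.

Variables (n : nat) (x : 'I_n -> F).
Hypotheses (x_inj : injective x) (x_neq0 : forall i, x i != 0).

Definition cross a := \prod_(j | j != a) ((x a - t * x j) / (x a - x j)).

(** Partial fractions of the product of [(1 - t x_i z)/(1 - x_i z)], denominators cleared. Both
    sides have degree at most [n] and agree at the [n+1] distinct points [0] and [1/x_a]. *)
Lemma lagrange_cross :
  lin_prod predT (fun i => t * x i) = lin_prod predT x +
  \sum_a ((1 - t) * x a * cross a)%:P * ('X * lin_prod (predC1 a) x).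
Proof.
apply/eqP; rewrite -subr_eq0; apply/eqP.
set p := _ - _.
have hE (P : pred 'I_n) c y : (lin_prod P c).[y] = \prod_(i | P i) (1 - c i * y).
  rewrite horner_prod; apply: eq_bigr => i _.
  by rewrite hornerD hornerN hornerM hornerX !hornerC.
apply: (@roots_geq_poly_eq0 _ _ (0 :: [seq (x a)^-1 | a <- enum 'I_n])).
- apply/allP => y; rewrite inE => /orP[/eqP->|/mapP[a _ ->]]; apply/eqP.
    rewrite /p hornerD hornerN hornerD horner_sum !hE.
    rewrite !big1 ?addr0 ?subrr // => i _; rewrite ?mulr0 ?subr0 //.
    by rewrite hornerM [('X * _).[_]]hornerM hornerX mul0r mulr0.
  rewrite /p hornerD hornerN hornerD horner_sum !hE.
  rewrite [X in _ - (X + _)](bigD1 a) //= mulfV // subrr mul0r add0r.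
  rewrite [X in _ - X](bigD1 a) //= [X in _ - (_ + X)]big1 ?addr0; last first.
    move=> b ba; rewrite !hornerM hE (bigD1 a) /=; last by rewrite eq_sym.
    by rewrite mulfV // subrr mul0r !mulr0.
  rewrite !hornerM hornerX hornerC hE (bigD1 a) //= -mulrA mulfV // mulr1.
  have -> : \prod_(i | i != a) (1 - t * x i / x a) =
      cross a * \prod_(i | predC1 a i) (1 - x i / x a).
    rewrite -big_split /=; apply: eq_bigr => i ia.
    have xai : x a - x i != 0 by rewrite subr_eq0 (inj_eq x_inj) eq_sym.
    by have := x_neq0 a; move=> xa; field; rewrite xa xai.
  apply/eqP; rewrite subr_eq0; apply/eqP.
  have := x_neq0 a; move: (cross a) (\prod_(i | _) _) => u v xa.
  by field.
- rewrite /= map_inj_uniq ?enum_uniq ?andbT; last by move=> a b /invr_inj/x_inj.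
  by apply/mapP => -[a _] /esym/eqP; rewrite invr_eq0 (negPf (x_neq0 a)).
rewrite /= size_map size_enum_ord (leq_trans (size_polyD _ _)) // size_polyN.
have sT c : (size (lin_prod (n := n) predT c) <= n.+1)%N.
  by apply: leq_trans (size_lin_prod _ _) _; rewrite card_ord.
rewrite geq_max sT (leq_trans (size_polyD _ _)) // geq_max sT.
apply: (leq_trans (size_sum _ _ _)); apply/bigmax_leqP => a _.
rewrite mul_polyC (leq_trans (size_scale_leq _ _)) //.
rewrite (leq_trans (size_polyMleq _ _)) // size_polyX add2n /= ltnS.
apply: leq_trans (size_lin_prod _ _) _.
by rewrite cardC1 card_ord; case: n a => [[]|].
Qed.

Lemma lin_prod_predC1_coef a m :
  (lin_prod (predC1 a) x)`_m = \sum_(i < m.+1) x a ^+ i * (lin_prod predT x)`_(m - i).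
Proof.
elim: m => [|m IHm]; first by rewrite big_ord_recl big_ord0 !lin_prod_coef0; ring.
have e : (lin_prod predT x)`_m.+1 = (lin_prod (predC1 a) x)`_m.+1 -
    x a * (lin_prod (predC1 a) x)`_m by rewrite (lin_prod_split a) coef_lin1M.
rewrite big_ord_recl expr0 mul1r subn0 e IHm mulr_sumr -addrA -[LHS]addr0.
congr (_ + _); rewrite addrC; apply/esym/eqP; rewrite subr_eq0; apply/eqP.
by apply: eq_bigr => i _; rewrite /= /bump leq0n add1n subSS exprS mulrA.
Qed.

(** Comparison of the coefficients of [z^n] in [lagrange_cross]. *)
Lemma sum_cross : (1 - t) * \sum_a cross a = 1 - t ^+ n.
Proof.
have /(congr1 (fun p : {poly F} => p`_n)) := lagrange_cross.
rewrite coefD coef_sum !lin_prod_top.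
have top a : x a * ('X * lin_prod (predC1 a) x)`_n = - \prod_i (- x i).
  rewrite -lin_prod_top (lin_prod_split a).
  have sz : (size (lin_prod (predC1 a) x) <= n)%N.
    apply: leq_trans (size_lin_prod _ _) _.
    by rewrite cardC1 card_ord; case: n a => [[]|].
  have key m : (size (lin_prod (predC1 a) x) <= m.+1)%N -> x a * ('X * lin_prod (predC1 a) x)`_m.+1 =
      - ((1 - (x a)%:P * 'X) * lin_prod (predC1 a) x)`_m.+1.
    by move=> szm; rewrite coefXM coef_lin1M /= [X in - (X - _)](nth_default _ szm) sub0r opprK.
  have n0 : (0 < n)%N by apply: leq_ltn_trans (ltn_ord a).
  by have := key n.-1; rewrite prednK //; apply.
have -> : \sum_a (((1 - t) * x a * cross a)%:P * ('X * lin_prod (predC1 a) x))`_n =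
    - ((1 - t) * (\sum_a cross a)) * \prod_i (- x i).
  rewrite mulNr -mulrN -mulrA mulr_suml mulr_sumr; apply: eq_bigr => a _.
  by rewrite coefCM -(top a); ring.
have -> : \prod_i - (t * x i) = t ^+ n * \prod_i (- x i).
  under eq_bigr => i _ do rewrite -mulrN.
  by rewrite big_split /= prodr_const card_ord.
have nz : \prod_i (- x i) != 0 by apply/prodf_neq0 => i _; rewrite oppr_eq0.
rewrite -[X in _ = X + _]mul1r -mulrDl => /(mulIf nz) ->.
by rewrite opprD opprK addrA subrr add0r.
Qed.

End PartialFractions.

(** * Jing words evaluated in variables are symmetrized products *)

Section Evaluation.
Variables (F : fieldType) (L : power_sum_algebra F) (t : F).
Hypothesis char0 : [pchar F] =i pred0.
Hypothesis t_generic : forall r : nat, (0 < r)%N -> t ^+ r != 1.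
Variables (K : fieldType) (iota : {rmorphism F -> K}).
Implicit Types (f : L).

Local Notation H := (@jing F L t).
Local Notation word := (@word F L t).
Local Notation tau := (iota t).

Definition eval_vars n (x : 'I_n -> K) : {rmorphism L -> K} :=
  psa_spec L iota (fun r => \sum_i x i ^+ r).

Lemma torsion_freeK : torsion_free K.
Proof.
move=> y n; rewrite -mulr_natl => /eqP.
rewrite mulf_eq0 -(rmorph_nat iota) fmorph_eq0.
by move/pcharf0P: char0 => -> /= /eqP.
Qed.

(** In the variables [x], [Q(z)] times the product of [1 - x_i z] is the product of [1 - t x_i z].
    By [lagrange_cross] the claimed coefficients satisfy the same relation, and a factor with
    constant term 1 cancels. *)
Lemma eval_hq n (x : 'I_n -> K) m : injective x -> (forall i, x i != 0) ->
  eval_vars x (hq L t m.+1) = (1 - tau) * \sum_a x a ^+ m.+1 * cross tau x a.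
Proof.
move=> x_inj x0.
pose s k := if k is k'.+1 then (1 - tau) * \sum_a x a ^+ k'.+1 * cross tau x a else 1.
suff : eval_vars x \o hq L t =1 s by move=> /(_ m.+1).
pose A k := (lin_prod predT x)`_k.
apply: (@conv_cancelr _ _ _ A); first exact: lin_prod_coef0.
have h1 := is_exp_conv (is_exp_rmorph (eval_vars x) (hq_is_exp L t char0))
                       (is_exp_lin_prod x).
have h2 := is_exp_lin_prod (fun i => tau * x i).
move=> k; rewrite (is_exp_uniq torsion_freeK h1 h2) => [|r r0 /=]; last first.
  rewrite psa_spec_scale psa_spec_pwr // rmorphB rmorph1 rmorphXn /=.
  under [in RHS]eq_bigr => i _ do rewrite exprMn.
  by rewrite -mulr_sumr; ring.
rewrite (lagrange_cross tau x_inj x0) coefD /conv big_ord_recl mul1r subn0.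
congr (_ + _); rewrite coef_sum.
case: k => [|k].
  by rewrite big_ord0 big1 // => a _; rewrite coefCM coefXM mulr0.
transitivity (\sum_a \sum_(i < k.+1) (1 - tau) * (x a ^+ i.+1 * cross tau x a) * A (k - i)%N).
  apply: eq_bigr => a _; rewrite coefCM coefXM /= lin_prod_predC1_coef mulr_sumr.
  by apply: eq_bigr => i _; rewrite -/(A _) exprS; ring.
rewrite exchange_big /=; apply: eq_bigr => i _.
by rewrite /bump leq0n add1n subSS -mulr_suml -mulr_sumr.
Qed.

Lemma eval_rem_var n (x : 'I_n.+1 -> K) a f :
  (map_poly (eval_vars x) (rem_var L f)).[x a] = eval_vars (x \o lift a) f.
Proof.
pose u : {rmorphism L -> K} :=
  horner_eval (x a) \o (map_poly (eval_vars x) \o rem_var L).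
have uE : u =1 eval_vars (x \o lift a).
  apply: psa_rmorph_ext => [c|r r0] /=.
    rewrite rem_var_const map_polyC /= horner_evalE hornerC.
    by rewrite !psa_spec_scale !rmorph1.
  rewrite rem_var_pwr // rmorphB /= map_polyC map_polyXn /= horner_evalE.
  rewrite hornerD hornerN hornerC hornerXn !psa_spec_pwr // (bigD1_ord a) //=.
  by rewrite addrAC subrr add0r.
by rewrite -uE.
Qed.

(** By [eval_hq] the sum over [m] evaluates [f[X - z]] at [z = x a], which deletes that variable. *)
Lemma eval_jing n (x : 'I_n.+1 -> K) r f : injective x -> (forall i, x i != 0) ->
  eval_vars x (H r.+1 f) =
  (1 - tau) * \sum_a x a ^+ r.+1 * cross tau x a * eval_vars (x \o lift a) f.
Proof.
move=> x_inj x0; rewrite jing_sum rmorph_sum.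
under eq_bigr => m _ do rewrite rmorphM addSn eval_hq // -mulrA.
rewrite -mulr_sumr; congr (_ * _).
under eq_bigr => m _ do rewrite mulr_suml.
rewrite exchange_big /=; apply: eq_bigr => a _.
rewrite -eval_rem_var (@horner_coef_wide _ (size (rem_var L f))); last exact: size_poly.
rewrite mulr_sumr; apply: eq_bigr => m _.
by rewrite coef_map /= -addSn exprD /shiftc; ring.
Qed.

Definition hl_sym n (la : seq nat) (x : 'I_n -> K) : K :=
  \sum_(w : 'S_n) (\prod_(i < n) x (w i) ^+ nth 0%N la i *
    \prod_(i < n) \prod_(j < n | (i < j)%N) ((x (w i) - tau * x (w j)) / (x (w i) - x (w j)))).

(** Permutations are grouped by the image [a] of the first index; the factors involving that index
    give the power of [x a] and [cross tau x a]. *)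
Lemma hl_sym_rec n la (x : 'I_n.+1 -> K) :
  hl_sym la x = \sum_a x a ^+ nth 0%N la 0 * cross tau x a *
                        hl_sym (behead la) (x \o lift a).
Proof.
pose h (p : 'I_n.+1 * 'S_n) := lift_perm ord0 p.1 p.2.
have h_inj : injective h.
  move=> [a v] [b w] e; have /= ab : a = b.
    by have := congr1 (fun s : 'S_n.+1 => s ord0) e; rewrite !lift_perm_id.
  rewrite {}ab in e *; congr (_, _); apply/permP => i; apply: (@lift_inj _ b).
  have := congr1 (fun s : 'S_n.+1 => s (lift ord0 i)) e.
  by rewrite /h /= !lift_perm_lift.
have h_bij : bijective h.
  by apply: inj_card_bij => //; rewrite card_prod card_ord !card_Sn factS.
rewrite /hl_sym (reindex h) /=; last exact: onW_bij.
rewrite -(pair_bigA _ (fun a (w : 'S_n) => (\prod_(i < n.+1) x (h (a, w) i) ^+ nth 0%N la i *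
    \prod_(i < n.+1) \prod_(j < n.+1 | (i < j)%N)
    ((x (h (a, w) i) - tau * x (h (a, w) j)) / (x (h (a, w) i) - x (h (a, w) j)))))) /=.
apply: eq_bigr => a _; rewrite mulr_sumr; apply: eq_bigr => w _.
rewrite /h /= big_ord_recl lift_perm_id -!mulrA; congr (_ * _).
rewrite [X in _ * X]big_ord_recl mulrCA; congr (_ * _).
  rewrite big_mkcond big_ord_recl /= mul1r /cross [RHS]big_mkcond (bigD1_ord a) //=.
  rewrite eqxx mul1r [RHS](reindex_perm w); apply: eq_bigr => j _.
  by rewrite lift_perm_id lift_perm_lift eq_sym neq_lift.
congr (_ * _).
  by apply: eq_bigr => i _; rewrite lift_perm_lift nth_behead.
apply: eq_bigr => i _; rewrite [LHS]big_mkcond big_ord_recl /= mul1r [RHS]big_mkcond.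
by apply: eq_bigr => j _; rewrite !lift_perm_lift.
Qed.

(** Both sides obey the same recursion while parts remain. Once [la] is exhausted, [sum_cross]
    produces the factor [hl_vfact] of the zero parts. *)
Lemma hl_sym_eval n la (x : 'I_n -> K) : injective x -> (forall i, x i != 0) ->
  0%N \notin la -> (size la <= n)%N ->
  hl_sym la x * (1 - tau) ^+ size la =
  iota (hl_vfact t (n - size la)) * eval_vars x (word la).
Proof.
have vS m : hl_vfact t m.+1 = hl_vfact t m * ((1 - t ^+ m.+1) / (1 - t)).
  by rewrite /hl_vfact big_nat_recr.
have t1 : 1 - t != 0 by rewrite -[t]expr1 one_sub_exp_neq0.
elim: n la x => [|n IHn] la x x_inj x0 la0 lan.
  have -> : la = [::] by apply/eqP; rewrite -size_eq0 -leqn0.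
  rewrite mulr1 rmorph1 mulr1 /hl_vfact big_geq // rmorph1 /hl_sym.
  under eq_bigr => w _ do rewrite !big_ord0 mulr1.
  by rewrite big_const card_Sn /= addr0.
have xl_inj a : injective (x \o lift a) by move=> i j /x_inj/lift_inj.
rewrite hl_sym_rec; case: la la0 lan => [|r la] /= la0 lan.
  rewrite mulr1 rmorph1 mulr1 subn0.
  have IH a : hl_sym [::] (x \o lift a) = iota (hl_vfact t n).
    by have := IHn [::] (x \o lift a); rewrite /= mulr1 rmorph1 mulr1 subn0; apply.
  under eq_bigr => a _ do rewrite mul1r IH.
  rewrite -mulr_suml vS rmorphM mulrC; congr (_ * _).
  have tau1 : 1 - tau != 0 by rewrite -(rmorph1 iota) -rmorphB fmorph_eq0.
  apply: (mulfI tau1); rewrite sum_cross // fmorph_div !rmorphB rmorph1 rmorphXn.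
  by rewrite [RHS]mulrC divfK.
move: la0; rewrite inE negb_or eq_sym -lt0n => /andP[r0 la0].
rewrite -(prednK r0) eval_jing // exprS mulrA [X in X * _]mulrC -mulrA mulr_suml.
rewrite [RHS]mulrCA; congr (_ * _); rewrite mulr_sumr; apply: eq_bigr => a _.
by rewrite -mulrA IHn // ?subSS 1?mulrCA // => i; apply: x0.
Qed.

End Evaluation.

(** * The sum over even partitions *)

Section EvenSum.
Variables (F : fieldType) (L : power_sum_algebra F) (t : F).
Hypothesis char0 : [pchar F] =i pred0.
Hypothesis t_generic : forall r : nat, (0 < r)%N -> t ^+ r != 1.
Variables (a b : F).
Implicit Types (f g : L) (s : seq nat).

Local Notation H := (@jing F L t).
Local Notation word := (@word F L t).
Local Notation spanned := (@spanned F L t).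
Local Notation functional := (functional L char0 t_generic).
Local Notation coordQ := (coordQ L char0 t_generic).
Local Notation hform := (hform char0 t_generic).
Local Notation dual_eval := (@dual_eval F L t).

Lemma vanishing_eq0 N f : vanishing N f -> f = 0.
Proof.
have [r [ri ->]] := word_expansion char0 t_generic f.
exact: (@word_indep F L t char0 t_generic N r L word).
Qed.

Lemma coordQ_support f : exists A : {fset intpart},
  (forall la : intpart, la \notin A -> coordQ la f = 0) /\
  f = \sum_(la <- A) coordQ la f *: word la.
Proof.
have [N Nf] := spanned_full char0 t_generic f.
elim: Nf => [|c s h si _ _ [A [A0 hE]]].
  exists fset0; split=> [la _|]; first by rewrite linear0.
  by rewrite big_seq_fset0.
pose l := IntPart si; exists (l |` A)%fset.
have cE (la : seq nat) : coordQ la (c *: word s + h) = c * (s == la)%:R + coordQ la h.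
  by rewrite linearP /= coordQ_word.
split=> [la|].
  rewrite in_fset1U negb_or => /andP[lal /A0 h0]; rewrite cE h0 addr0.
  case: eqP => [e|_]; last by rewrite mulr0.
  by move: lal; rewrite -val_eqE /= -e eqxx.
under eq_bigr => la _ do rewrite cE scalerDl.
rewrite big_split /=; congr (_ + _).
  rewrite (bigD1_seq l) ?fset_uniq ?fset1U1 //= eqxx mulr1 big1 ?addr0 // => la lal.
  by rewrite eq_sym -[parts la]/(val la) -[s]/(val l) val_eqE (negPf lal) mulr0 scale0r.
rewrite {1}hE; apply: big_fset_incl => [|la _ /A0 ->]; first exact: fsubsetU1.
by rewrite scale0r.
Qed.

Lemma aug_hform f : aug L f = hform 1 f.
Proof.
have [N Nf] := spanned_full char0 t_generic f.
elim: Nf => [|c s h si _ _ IH]; first by rewrite rmorph0 linear0.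
rewrite rmorphD psa_spec_scale IH linearP /= aug_word // hform_word //.
rewrite (@coordQ_word _ _ _ _ _ s [::]) // [[::] == s]eq_sym /GRing.scale /=.
by case: eqP => [->|_]; rewrite ?mulr0 // /hl_b big_nil mul1r.
Qed.

(** A truncation of the kernel representing [D_a D_b]. For words with at most [n] parts the omitted
    terms contribute nothing, since the dual shift vanishes beyond the length. *)
Definition e_kernel n : L :=
  \sum_(k < n.+1) \sum_(l < n.+1) ((- a) ^+ k * (- b) ^+ l) *: (he L l * he L k).

Lemma e_kernel_adjoint n s f : 0%N \notin s -> (size s <= n)%N ->
  hform (e_kernel n * f) (word s) = hform f (dual_eval a (dual_eval b (word s))).
Proof.
move=> s0 sn.
have sz k g : (forall j, (n < j)%N -> dshift t j g = 0) ->
    dual_eval k g = \sum_(j < n.+1) k ^+ j *: dshift t j g.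
  by move=> gn; apply: dual_evalE; apply/leq_sizeP => j /gn.
have top j : (n < j)%N -> dshift t j (word s) = 0.
  by move=> nj; apply: dshift_word_gt => //; apply: leq_ltn_trans nj.
have -> : dual_eval a (dual_eval b (word s)) =
    \sum_(k < n.+1) \sum_(l < n.+1) (a ^+ k * b ^+ l) *: dshift t k (dshift t l (word s)).
  rewrite (sz b) // exchange_big (rmorph_sum (dual_eval a)); apply: eq_bigr => l _.
  rewrite -[LHS]/(dual_eval a (b ^+ l *: dshift t l (word s))) dual_evalZ sz.
    rewrite scaler_sumr; apply: eq_bigr => k _.
    by rewrite scalerA mulrC.
  by move=> j nj; rewrite /dshift shiftc_comm -/(dshift t j _) top // linear0.
rewrite /e_kernel mulr_suml hform_suml hform_sumr; apply: eq_bigr => k _.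
rewrite mulr_suml hform_suml hform_sumr; apply: eq_bigr => l _.
rewrite -scalerAl hformZl hformZr -[he L l * _ * f]mulrA !hform_adjoint.
by rewrite [(- a) ^+ k]exprNn [(- b) ^+ l]exprNn -(signr_odd F k) -(signr_odd F l);
   case: (odd k); case: (odd l); rewrite ?expr0 ?expr1; ring.
Qed.

Definition even_sum : {linear L -> F^o} :=
  functional (V := F^o) (fun s => (even_partition s)%:R).

Lemma even_sum_weight : part_weight t (fun N => (~~ odd N)%:R) even_sum.
Proof.
move=> N f; case: N => [/spanned0_const[c ->]|N Nf].
  by rewrite linearZ /= jing1 // hq0 mul1r.
elim: Nf => [|c s h si sN _ IH]; first by rewrite !linear0 mulr0.
rewrite !linearP /= -/(jing _ _ _) IH mulrDr; congr (_ + _).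
rewrite -[H N.+1 (word s)]/(word (N.+1 :: s)) !functionalE //; last first.
  by rewrite is_intpart_cons /= sN.
by rewrite /GRing.scale /=; case: odd; rewrite /= ?mul0r ?mulr0 ?mul1r.
Qed.

Lemma dual_eval1 x : dual_eval x 1 = 1.
Proof. exact: rmorph1. Qed.

Definition odd_sum : {linear L -> F^o} := even_sum \o dual_eval a.

Lemma odd_sumE f : odd_sum f = even_sum (dual_eval a f).
Proof. by []. Qed.

(** The one-letter version of the result. With the weight [[N even]], the binomial sum for a block
    of [N.+1] keeps only [i = 0] if [N.+1] is even and only [i = m] if it is odd. *)
Lemma odd_sum_weight : part_weight t (fun N => if odd N then - a else 1) odd_sum.
Proof.
have blk N m f : spanned N f ->
    odd_sum (iter m (H N.+1) f) = (if odd N.+1 then - a else 1) ^+ m * odd_sum f.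
  move=> Nf; rewrite !odd_sumE.
  rewrite (part_weight_dual_eval char0 t_generic a m even_sum_weight Nf).
  congr (_ * _); rewrite /=; case: (odd N) => /=.
    rewrite big_ord_recl [X in _ + X]big1 => [|i _].
      by rewrite tbin0 // !expr1n expr0 !mulr1 addr0.
    by rewrite mulr0 expr0n /= mulr0 mul0r.
  rewrite big_ord_recr /= [X in X + _]big1 => [|i _].
    by rewrite tbinn // subnn expr0 !mulr1 mul1r add0r.
  by rewrite expr0n subn_eq0 leqNgt ltn_ord mulr0.
move=> [|N] f Nf.
  by case: (spanned0_const Nf) => c ->; rewrite linearZ /= jing1 // hq0 mul1r.
elim/spanned_block_ind: Nf => {f} [|f g IHf IHg|c f IH|m f Nf].
- by rewrite !linear0 mulr0.
- by rewrite linearD (linearD odd_sum) IHf IHg (linearD odd_sum) mulrDr.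
- have oZ d g : odd_sum (d *: g) = d * odd_sum g by exact: linearZ.
  by rewrite [H N.+1 _]linearZ !oZ IH mulrCA.
by rewrite -iterS !blk // exprS mulrA.
Qed.

(** The second letter is applied block by block, using the weight found for the first; induction on
    the largest allowed part. *)
Lemma odd_sum_word N s : a != 0 -> is_intpart s -> all (leq^~ N) s ->
  odd_sum (dual_eval b (word s)) =
  (- a) ^+ size (odd_parts s) * rs_h t (even_parts s) (a * b) * rs_h t (odd_parts s) (b / a).
Proof.
move=> a0 si sN.
elim: N s si sN => [|N IHN] s si sN.
  have -> : s = [::].
    by case: s si sN => // x s; rewrite is_intpart_cons /= leqn0 => /andP[/lt0n_neq0/negPf->].
  have e1 : even_sum 1 = 1 by rewrite /even_sum (@functionalE _ _ _ _ _ _ _ [::]).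
  by rewrite odd_sumE !dual_eval1 e1 /rs_h !big_nil !mulr1.
have [m [s' [-> s'i s'N]]] := intpart_block si sN.
have Ns' : spanned N (word s') by exact: spanned_word.
rewrite word_nseq (part_weight_dual_eval char0 t_generic b m odd_sum_weight Ns') IHN //.
rewrite /odd_parts /even_parts !filter_cat !filter_nseq /=.
have s'N1 p : N.+1 \notin [seq i <- s' | p i].
  by rewrite mem_filter negb_and notin_block ?orbT.
have rs0 z : rogers_szego t 0 z = 1.
  by rewrite /rogers_szego big_ord1 expr0 mul1r /tbinom tfact0 mulr1 divr1.
have tbE (i : 'I_m.+1) : tbin t m i = tbinom t m i by rewrite /tbin -ltnS ltn_ord.
(* For [N] odd the block consists of even parts, with weights [-a] below and 1 at the top, giving
   powers of [ab]. For [N] even the weights are exchanged, and extracting [(-a)^m] leaves powers of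
   [b/a]. *)
case oN: (odd N); rewrite /= ?mul1n ?mul0n /=.
  have -> : rs_h t (nseq m N.+1 ++ [seq i <- s' | ~~ odd i]) (a * b) =
      rogers_szego t m (a * b) * rs_h t [seq i <- s' | ~~ odd i] (a * b).
    exact: (@block_prod _ (fun n => rogers_szego t n (a * b))).
  have -> : \sum_(i < m.+1) tbin t m i * (- b * - a) ^+ i * 1 ^+ (m - i) =
      rogers_szego t m (a * b).
    by apply: eq_bigr => i _; rewrite tbE expr1n mulr1 mulrNN mulrC [b * a]mulrC.
  by ring.
have -> : rs_h t (nseq m N.+1 ++ [seq i <- s' | odd i]) (b / a) =
    rogers_szego t m (b / a) * rs_h t [seq i <- s' | odd i] (b / a).
  exact: (@block_prod _ (fun n => rogers_szego t n (b / a))).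
have -> : \sum_(i < m.+1) tbin t m i * (- b * 1) ^+ i * (- a) ^+ (m - i) =
    (- a) ^+ m * rogers_szego t m (b / a).
  rewrite /rogers_szego mulr_sumr; apply: eq_bigr => i _.
  have im : (i <= m)%N by rewrite -ltnS.
  have -> : - b * 1 = - a * (b / a) by field.
  have -> : (- a) ^+ m = (- a) ^+ i * (- a) ^+ (m - i) by rewrite -exprD subnKC.
  by rewrite tbE exprMn; ring.
by rewrite size_cat size_nseq exprD; ring.
Qed.

End EvenSum.

(** * Words as Hall-Littlewood functions, and skewing by the kernel *)

Section HallLittlewoodWords.
Variables (F : fieldType) (L : power_sum_algebra F) (t : F).
Hypothesis char0 : [pchar F] =i pred0.
Hypothesis t_generic : forall r : nat, (0 < r)%N -> t ^+ r != 1.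
Implicit Types (f g : L).

Local Notation word := (@word F L t).
Local Notation coordQ := (coordQ L char0 t_generic).
Local Notation hform := (hform char0 t_generic).
Local Notation dual_eval := (@dual_eval F L t).
Local Notation tofrac := (@FracField.tofrac _).

Definition wordP (s : seq nat) : L := (hl_b t s)^-1 *: word s.

Lemma hl_b_neq0 s : hl_b t s != 0.
Proof.
apply: (big_ind (fun x => x != 0)) => [|x y x0 y0|i _]; first exact: oner_neq0.
  exact: mulf_neq0.
exact: tfact_neq0.
Qed.

Lemma wordPE s : hl_b t s *: wordP s = word s.
Proof. by rewrite /wordP scalerA mulfV ?hl_b_neq0 // scale1r. Qed.

Lemma hform_wordP s u : is_intpart s -> is_intpart u ->
  hform (wordP s) (word u) = (u == s)%:R.
Proof.
move=> si ui; rewrite hformZl hform_word // coordQ_word // eq_sym.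
by case: eqP => [->|_]; rewrite ?mulr0 // mulr1 mulVf // hl_b_neq0.
Qed.

Lemma one_sub_t_neq0 : 1 - t != 0.
Proof. by rewrite -[t]expr1 one_sub_exp_neq0. Qed.

Lemma hl_vfactE m : hl_vfact t m = tfact t m / (1 - t) ^+ m.
Proof.
elim: m => [|m IHm]; first by rewrite /hl_vfact big_geq // tfact0 divr1.
by rewrite /hl_vfact big_nat_recr //= -/(hl_vfact t m) IHm tfactS [(1 - t) ^+ m.+1]exprSr mulf_div.
Qed.

Lemma hl_vE n s : hl_v t n s = hl_vfact t (n - size s) * (hl_b t s / (1 - t) ^+ size s).
Proof.
rewrite /hl_v; congr (_ * _); under eq_bigr => i _ do rewrite hl_vfactE.
rewrite big_split /=; congr (_ * _); under eq_bigr => i _ do rewrite -exprVn.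
rewrite -exprVn; set c := (1 - t)^-1.
have -> : \prod_(i <- undup s) c ^+ count_mem i s = \prod_(i <- s) c.
  exact: (big_undup_iterop_count *%R s predT (fun=> c)).
by rewrite big_const_seq count_predT iter_mulr_1.
Qed.

(** [hl_sym_eval] applied to the indeterminates in the fraction field, with the normalizations
    matched through [hl_vE]. *)
Lemma hl_frac_word n s : is_intpart s -> (size s <= n)%N ->
  tofrac (restr L n (wordP s)) = hl_frac t n s.
Proof.
move=> si sn.
pose iota : {rmorphism F -> {fraction {mpoly F[n]}}} := tofrac \o @mpolyC n F.
pose x i : {fraction {mpoly F[n]}} := tofrac ('X_i : {mpoly F[n]}).
have x_inj : injective x.
  move=> i j /eqP; rewrite tofrac_eq => /eqP/(congr1 (mcoeff U_(i)%MM)).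
  by rewrite !mcoeffXU eqxx eq_sym; case: eqP => // _ /eqP; rewrite oner_eq0.
have x_neq0 i : x i != 0.
  rewrite tofrac_eq0; apply/eqP => /(congr1 (mcoeff U_(i)%MM)).
  by rewrite mcoeffXU eqxx mcoeff0 => /eqP; rewrite oner_eq0.
have evE : tofrac \o restr L n =1 eval_vars L iota x.
  apply: psa_rmorph_ext => [c|r r0] /=; first by rewrite !psa_spec_scale !rmorph1 !mulr1.
  by rewrite !psa_spec_pwr // rmorph_sum; apply: eq_bigr => i _; rewrite rmorphXn.
have s0 : 0%N \notin s by case/andP: si.
have symE : \sum_(w : 'S_n) tofrac (msym w (hl_num t n s)) / tofrac (msym w (hl_den F n)) =
    hl_sym t iota s x.
  apply: eq_bigr => w _; rewrite /hl_num /hl_den msymM rmorphM -mulrA; congr (_ * _).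
    rewrite mpolyXE_id !rmorph_prod; apply: eq_bigr => i _.
    by rewrite !rmorphXn mnmE /= /msym mmapX mmap1U.
  rewrite !rmorph_prod -prodf_div; apply: eq_bigr => i _.
  rewrite !rmorph_prod -prodf_div; apply: eq_bigr => j _.
  rewrite !rmorphB /= msymZ -mul_mpolyC rmorphM /=.
  by rewrite /msym !mmapX !mmap1U.
have := hl_sym_eval L char0 t_generic iota x_inj x_neq0 s0 sn.
rewrite /hl_frac symE -evE /= => e.
have tau1 : iota (1 - t) != 0 by rewrite fmorph_eq0 one_sub_t_neq0.
rewrite psa_spec_scale rmorphM /= -/(iota _) -/(iota _).
have vn0 : hl_vfact t (n - size s) != 0.
  by rewrite hl_vfactE mulf_neq0 ?invr_eq0 ?expf_neq0 ?tfact_neq0 ?one_sub_t_neq0.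
have -> : hl_sym t iota s x =
   iota (hl_vfact t (n - size s)) * tofrac (restr L n (word s)) / iota (1 - t) ^+ size s.
  rewrite -e rmorphB rmorph1 mulfK // expf_neq0 //.
  by move: tau1; rewrite rmorphB rmorph1.
have -> : (hl_b t s)^-1 = (hl_v t n s)^-1 * hl_vfact t (n - size s) / (1 - t) ^+ size s.
  rewrite hl_vE; field.
  by rewrite vn0 hl_b_neq0 expf_neq0 // one_sub_t_neq0.
rewrite -[LHS]/(iota (_ * _ / _) * tofrac (restr L n (word s))).
rewrite -[tofrac (mpolyC n _)]/(iota (hl_v t n s)^-1).
by rewrite !(rmorphM iota) (fmorphV iota (_ ^+ _)) (rmorphXn iota); ring.
Qed.

Lemma wordP_unique s f : is_intpart s ->
  (forall n, (size s <= n)%N -> tofrac (restr L n f) = hl_frac t n s) -> f = wordP s.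
Proof.
move=> si fE; apply/eqP; rewrite -subr_eq0; apply/eqP.
apply: (@vanishing_eq0 _ _ _ char0 t_generic (size s)) => n sn.
apply/eqP; rewrite rmorphB subr_eq0 -tofrac_eq fE // hl_frac_word //.
Qed.

Lemma coordP_support f : exists A : {fset intpart},
  (forall la : intpart, la \notin A -> hform f (word la) = 0) /\
  f = \sum_(la <- A) hform f (word la) *: wordP la.
Proof.
have [A [A0 fE]] := coordQ_support char0 t_generic f.
have cE (la : intpart) : hform f (word la) = hl_b t la * coordQ la f.
  by rewrite hform_word //; case: la.
exists A; split=> [la /A0 c0|]; first by rewrite cE c0 mulr0.
rewrite {1}fE; apply: eq_bigr => la _.
by rewrite cE mulrC -scalerA wordPE.
Qed.

(** A single truncation, at the weight of [la], serves all [nu]: if [nu] is larger than [la] the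
    structure constant vanishes by degree, otherwise its length is within the truncation. *)
Lemma skew_kernel a b (mu la nu : intpart) :
  hform (wordP mu * wordP nu) (word la) * aug L (dual_eval a (dual_eval b (word nu))) =
  hform (wordP mu * wordP nu) (word la) * hform (e_kernel L a b (sumn la)) (word nu).
Proof.
case: la mu nu => la lai [mu mui] [nu nui] /=.
have size_sumn s : is_intpart s -> (size s <= sumn s)%N.
  by move=> si; rewrite -(sumn_col_remove si) leq_addl.
case: (leqP (sumn nu) (sumn la)) => [nula|lanu].
  rewrite (aug_hform char0 t_generic) -(@e_kernel_adjoint _ _ _ char0 t_generic a b (sumn la)).
  - by rewrite mulr1.
  - by case/andP: nui.
  - exact: leq_trans (size_sumn _ nui) nula.
suff -> : hform (wordP mu * wordP nu) (word la) = 0 by rewrite !mul0r.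
rewrite hform_word // (@graded_coordQ _ _ _ char0 t_generic (sumn mu + sumn nu)) ?mulr0 //.
  by apply: gradedM; apply: gradedZ; apply: graded_word.
by rewrite ltn_eqF // ltn_addl.
Qed.

(** Expanding the kernel in the basis [P_nu] resums the left side to the pairing of the kernel times
    [P_mu] with [Q_la]; adjointness then moves the kernel onto [Q_la]. *)
Lemma skew_kernel_sum a b (mu la : intpart) (A : {fset intpart}) :
  (forall nu : intpart, nu \notin A -> hform (wordP mu * wordP nu) (word la) = 0) ->
  \sum_(nu <- A) hform (wordP mu * wordP nu) (word la) *
     aug L (dual_eval a (dual_eval b (word nu))) =
  coordQ mu (dual_eval a (dual_eval b (word la))).
Proof.
move=> A0; pose y := e_kernel L a b (sumn la).
pose G (nu : intpart) := hform (wordP mu * wordP nu) (word la) * hform y (word nu).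
have [B [B0 yE]] := coordP_support y.
(* The sum over all partitions links [A], the support of the structure constants, with [B], the
   support of the kernel. *)
transitivity (\sum_(nu \in [set: intpart]%classic) G nu).
  rewrite (fsbigTE A) => [|nu /A0]; last by rewrite /G => ->; rewrite mul0r.
  by apply: eq_bigr => nu _; rewrite skew_kernel.
rewrite (fsbigTE B) => [|nu /B0]; last by rewrite /G => ->; rewrite mulr0.
have lai := valP la; have mui := valP mu; rewrite /= in lai mui.
transitivity (hform (y * wordP mu) (word la)).
  rewrite {1}yE mulr_suml hform_suml; apply: eq_bigr => nu _.
  transitivity (hform (hform y (word nu) *: (wordP mu * wordP nu)) (word la)).
    by rewrite hformZl mulrC.
  by congr (hform _ _); rewrite [wordP mu * _]mulrC; exact: scalerAl.
rewrite (@e_kernel_adjoint _ _ _ char0 t_generic a b (sumn la)); last 2 first.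
- by case/andP: lai.
- by rewrite -(sumn_col_remove lai) leq_addl.
rewrite /wordP hformZl hform_sym hform_word // mulrA mulVf ?mul1r //.
exact: hl_b_neq0.
Qed.

Lemma even_coordQ_sum f :
  \sum_(mu \in [set mu : intpart | even_partition mu]%classic) coordQ mu f =
  even_sum L char0 t_generic f.
Proof.
have [A [A0 fE]] := coordQ_support char0 t_generic f.
rewrite fsbig_mkcond (fsbigTE A); last first.
  by move=> mu /A0 c0; rewrite /functions.patch; case: ifP.
rewrite {2}fE linear_sum; apply: eq_bigr => mu _.
rewrite linearZ /= functionalE; last by case: (mu).
rewrite /functions.patch; case: ifPn => [/set_mem /= ->|/negP nE].
  by rewrite /GRing.scale /= mulr1.
have /negPf -> : ~~ even_partition mu by apply/negP => mue; apply/nE/mem_set.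
by rewrite /GRing.scale /= mulr0.
Qed.

Lemma graded_finite_support (mu la : intpart) : exists A : {fset intpart},
  forall nu : intpart, nu \notin A -> hform (wordP mu * wordP nu) (word la) = 0.
Proof.
pose K := sumn la.
(* By degree only [nu] of weight at most [K] occur; their length and their parts are then at most
   [K]. *)
pose seqs := flatten [seq [seq map val (tval u) | u : k.-tuple 'I_K.+1] | k <- iota 0 K.+1].
exists [fset nu in pmap insub seqs]%fset => nu.
rewrite in_fset /= mem_pmap_sub => nuA.
have lai := valP la; have mui := valP mu; have nui := valP nu; rewrite /= in lai mui nui.
rewrite hform_word // (@graded_coordQ _ _ _ char0 t_generic (sumn mu + sumn nu)) ?mulr0 //.
  by apply: gradedM; apply: gradedZ; apply: graded_word.
apply: contra nuA => /eqP laE.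
have nuK : (sumn nu <= K)%N by rewrite /K laE leq_addl.
have nu_le x : x \in parts nu -> (x < K.+1)%N.
  move=> xnu; rewrite ltnS; apply: leq_trans nuK.
  by rewrite sumnE (big_rem x) //= leq_addr.
apply/flattenP; exists [seq map val (tval u) | u : (size nu).-tuple 'I_K.+1].
  apply/mapP; exists (size nu) => //; rewrite mem_iota /= add0n ltnS.
  by apply: leq_trans nuK; rewrite -(sumn_col_remove nui) leq_addl.
apply/mapP; exists (map_tuple inord (in_tuple (parts nu))); first by rewrite mem_enum.
rewrite /=.
rewrite -map_comp -[LHS]map_id; apply/eq_in_map => x /nu_le xK /=.
by rewrite inordK.
Qed.

Lemma dual_eval_pwr x r : (0 < r)%N ->
  dual_eval x (pwr L r) = pwr L r + (- (x ^+ r / (1 - t ^+ r))) *: 1.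
Proof.
move=> r0; rewrite /dual_eval /= /dual_shift shift_pwr // horner_evalE hornerD hornerM.
by rewrite !hornerC hornerXn exprZn expr1n mulr_algl scalerA mulNr mulrC.
Qed.

Lemma aug_dual_eval a b f :
  psa_spec L idfun (fun r => - (a ^+ r + b ^+ r) / (1 - t ^+ r)) f =
  aug L (dual_eval a (dual_eval b f)).
Proof.
pose u : {rmorphism L -> F} := aug L \o (dual_eval a \o dual_eval b).
suff e : psa_spec L idfun (fun r => - (a ^+ r + b ^+ r) / (1 - t ^+ r)) =1 u by exact: e.
apply: psa_rmorph_ext => [c|r r0].
  rewrite -[RHS]/(aug L (dual_eval a (dual_eval b (c *: 1)))) !dual_evalZ !dual_eval1.
  by rewrite !psa_spec_scale !rmorph1.
rewrite -[RHS]/(aug L (dual_eval a (dual_eval b (pwr L r)))) dual_eval_pwr //.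
rewrite (rmorphD (dual_eval a)) dual_evalZ dual_eval1 dual_eval_pwr //.
rewrite !rmorphD !psa_spec_scale !rmorph1 !psa_spec_pwr // !mulr1.
by rewrite add0r -opprD -mulrDl mulNr.
Qed.

End HallLittlewoodWords.

Definition symfun_algebra (F : fieldType) : power_sum_algebra F :=
  @PowerSumAlgebra F (symfun F) (@psum F) (@specialize F)
    (@specialize_scale F) (@specialize_psum F) (@symfun_ind F).

(** * Identification with the defined functions and conclusion *)

Section HallLittlewoodFunctions.
Variables (F : fieldType) (t : F).
Hypothesis char0 : [pchar F] =i pred0.
Hypothesis t_generic : forall r : nat, (0 < r)%N -> t ^+ r != 1.

Local Notation L := (symfun_algebra F).
Local Notation word := (@word F L t).
Local Notation wordP := (@wordP F L t).
Local Notation coordQ := (coordQ L char0 t_generic).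
Local Notation hform := (@hform F L t char0 t_generic).
Local Notation dual_eval := (@dual_eval F L t).

(** The choice in [hl_P] is determined: [wordP] has the required restrictions, and two candidates
    differ by an element vanishing in all large numbers of variables, hence by 0. *)
Lemma hl_P_word (la : intpart) : hl_P t la = wordP la.
Proof.
have lai := valP la; rewrite /= in lai.
apply: xget_unique => [n sn|f fE]; first exact: (@hl_frac_word F L t char0 t_generic n la lai sn).
exact: (@wordP_unique F L t char0 t_generic la f lai fE).
Qed.

Lemma hl_Q_word (la : intpart) : hl_Q t la = word la.
Proof. by rewrite /hl_Q hl_P_word; apply: (@wordPE F L t t_generic). Qed.

(** The pairings with the words give one finite expansion in the [P_la]; pairing any other expansion
    with [word mu] recovers its coefficient at [mu], so the choice is forced. *)
Lemma hl_coord_hform (f : L) (la : intpart) : hl_coord t f la = hform f (word la).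
Proof.
rewrite /hl_coord.
set C := (X in xget _ X).
have Cx : C (fun mu : intpart => hform f (word mu)).
  have [A [A0 fE]] := coordP_support char0 t_generic f.
  split.
    apply: (sub_finite_set _ (finite_fset A)) => mu /= nz.
    by apply/negPn/negP => /A0 /eqP; rewrite (negPf nz).
  rewrite (fsbigTE A) => [|mu /A0 ->]; last by rewrite scale0r.
  by rewrite {1}fE; apply: eq_bigr => mu _; rewrite hl_P_word.
have Cu c : C c -> forall mu : intpart, c mu = hform f (word mu).
  move=> [fin ->] mu.
  have c0 nu : nu \notin fset_set [set la | c la != 0]%classic -> c nu = 0.
    by rewrite in_fset_set // notin_setE /= => /negP/negPn/eqP.
  rewrite (fsbigTE (fset_set [set la | c la != 0]%classic)); last first.
    by move=> nu /c0 ->; rewrite scale0r.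
  rewrite hform_suml.
  under eq_bigr => nu _ do rewrite hl_P_word hformZl hform_wordP ?(valP nu) ?(valP mu) //.
  case: (boolP (mu \in fset_set [set la | c la != 0]%classic)) => mA; last first.
    rewrite c0 // big_seq big1 // => nu nuA; case: eqP => [e|_]; last by rewrite mulr0.
    by move: mA; rewrite (val_inj e) nuA.
  rewrite (bigD1_seq mu) ?fset_uniq //= eqxx mulr1 big1 ?addr0 // => nu num.
  by case: eqP => [/val_inj e|_]; [rewrite e eqxx in num|rewrite mulr0].
by apply: Cu; apply: xgetI Cx.
Qed.

Lemma hl_skewQ'_coordQ (a b : F) (la mu : intpart) :
  hl_skewQ' t a b la mu = coordQ mu (dual_eval a (dual_eval b (word la))).
Proof.
have [A A0] := graded_finite_support L char0 t_generic mu la.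
have sE (nu : intpart) : hl_struct t la mu nu = hform (wordP mu * wordP nu) (word la).
  by rewrite /hl_struct hl_coord_hform !hl_P_word.
rewrite /hl_skewQ' /hl_skewQ (fsbigTE A); last first.
  by move=> nu /A0 nu0; rewrite sE nu0 scale0r.
rewrite rmorph_sum -(skew_kernel_sum a b A0).
apply: eq_bigr => nu _; rewrite specialize_scale sE hl_Q_word; congr (_ * _).
exact: (@aug_dual_eval F L t).
Qed.

End HallLittlewoodFunctions.

Theorem theorem4p1 (F : fieldType) (char0 : [pchar F] =i pred0)
    (t : F) (t_generic : forall r : nat, (0 < r)%N -> t ^+ r != 1)
    (a b : F) (a_neq0 : a != 0) (la : intpart) :
  \sum_(mu \in [set mu : intpart | even_partition mu]%classic)
     hl_skewQ' t a b la mu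
  = (- a) ^+ size (odd_parts la) *
    rs_h t (even_parts la) (a * b) * rs_h t (odd_parts la) (b / a).
Proof.
have lai := valP la; rewrite /= in lai.
under eq_fsbigr => mu _ do rewrite (hl_skewQ'_coordQ char0 t_generic).
rewrite even_coordQ_sum -odd_sumE.
(* The induction bound may be any number at least as large as every part; the weight of [la] is
   one. *)
apply: (@odd_sum_word F (symfun_algebra F) t char0 t_generic a b (sumn la)) => //.
apply/allP => x xla /=.
by rewrite sumnE (big_rem x) //= leq_addr.
Qed.
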